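(* Let $r\ge 2$, $n\ge 1$ and $0\le k\le n$ be integers. As ungraded $G_n$-modules we have $R_{n,k}\cong \mathbb{C}[\mathcal{F}_{n,k}]$ and $S_{n,k}\cong\mathbb{C}[\mathcal{OP}_{n,k}]$.
   Context: Let $\zeta=e^{2\pi i/r}$. $G_n$ is the group of $n\times n$ monomial matrices (exactly one nonzero entry in each row and column) whose nonzero entries are $r$-th roots of unity; it is generated by the permutation matrices $\pi\in\mathfrak{S}_n$ and the diagonal matrices $\mathrm{diag}(g_1,\dots,g_n)$ with $g_i^r=1$. It acts on $\mathbb{C}[x_1,\dots,x_n]$ by graded algebra automorphisms given by $\pi.x_\ell=x_{\pi_\ell}$ and $\mathrm{diag}(g_1,\dots,g_n).x_\ell=g_\ell^{-1}x_\ell$. Let $e_d(\mathbf{x}_n^r)=e_d(x_1^r,\dots,x_n^r)$ be the $d$-th elementary symmetric polynomial in $x_1^r,\dots,x_n^r$. Define the $G_n$-stable homogeneous ideals $$I_{n,k}=\langle x_1^{kr+1},\dots,x_n^{kr+1},e_n(\mathbf{x}_n^r),e_{n-1}(\mathbf{x}_n^r),\dots,e_{n-k+1}(\mathbf{x}_n^r)\rangle,$$ $$J_{n,k}=\langle x_1^{kr},\dots,x_n^{kr},e_n(\mathbf{x}_n^r),e_{n-1}(\mathbf{x}_n^r),\dots,e_{n-k+1}(\mathbf{x}_n^r)\rangle$$ and $R_{n,k}=\mathbb{C}[x_1,\dots,x_n]/I_{n,k}$, $S_{n,k}=\mathbb{C}[x_1,\dots,x_n]/J_{n,k}$. A $G_n$-face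 is an ordered set partition $\sigma=(B_1\mid\cdots\mid B_m)$ of $[n]=\{1,\dots,n\}$ (nonempty blocks) in which every letter of every block, with the possible exception of the first block $B_1$, carries a color in $\{0,1,\dots,r-1\}$; either all letters of $B_1$ are colored or all are uncolored. If the letters of $B_1$ are uncolored, $B_1$ is called the zero block of $\sigma$. The dimension of $\sigma$ is its number of nonzero blocks. $\mathcal{F}_{n,k}$ is the set of $G_n$-faces of dimension $k$, and $\mathcal{OP}_{n,k}\subseteq\mathcal{F}_{n,k}$ is the set of those without zero block (i.e. $r$-colored ordered set partitions of $[n]$ with $k$ blocks). $G_n$ acts on $\mathcal{F}_{n,k}$, preserving $\mathcal{OP}_{n,k}$: a permutation $\pi$ replaces each letter $i$ by $\pi_i$, preserving colors; $\mathrm{diag}(\zeta^{c_1},\dots,\zeta^{c_n})$ increases the color of the letter $i$ by $c_i$ modulo $r$, leaving zero block letters uncolored. $\mathbb{C}[X]$ denotes the permutation module on a $G_n$-set $X$. *)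

(* Defs.v *)
From HB Require Import structures.
From mathcomp Require Import all_boot all_order all_algebra fingroup perm.
From mathcomp Require Import generic_quotient ring_quotient.
From mathcomp Require Import complex mpoly.
From mathcomp Require Import boolp reals trigo.

Set Implicit Arguments.
Unset Strict Implicit.
Unset Printing Implicit Defensive.

Import GRing.Theory Num.Theory Order.TTheory.

Local Open Scope ring_scope.
Local Open Scope quotient_scope.

Record gset (G : groupType) := GSet {
  gset_sort :> finType;
  gset_act : G -> gset_sort -> gset_sort;
  gset_act1 : forall x, gset_act 1%g x = x;
  gset_actM : forall g h x, gset_act (g * h)%g x = gset_act g (gset_act h x)
}.

Record gmodule (K : nzRingType) (G : groupType) := GModule {
  gmod_sort :> lmodType K;
  gmod_act : G -> gmod_sort -> gmod_sort;
  gmod_act_lin : forall g, linear (gmod_act g);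
  gmod_act1 : forall v, gmod_act 1%g v = v;
  gmod_actM : forall g h v, gmod_act (g * h)%g v = gmod_act g (gmod_act h v)
}.

Definition gmod_iso (K : nzRingType) (G : groupType) (V W : gmodule K G) : Prop :=
  exists f : {linear V -> W},
    bijective f /\ forall g v, f (gmod_act g v) = gmod_act g (f v).

Section SubGSet.
Variables (G : groupType) (X : gset G) (P : pred X).
Hypothesis P_stable : forall g x, P x -> P (gset_act g x).

Definition sub_gset_act (g : G) (x : {x : X | P x}) : {x : X | P x} :=
  exist _ (gset_act g (val x)) (P_stable g (valP x)).

Lemma sub_gset_act1 x : sub_gset_act 1%g x = x.
Proof. by apply: val_inj; rewrite /= gset_act1. Qed.

Lemma sub_gset_actM g h x :
  sub_gset_act (g * h)%g x = sub_gset_act g (sub_gset_act h x).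
Proof. by apply: val_inj; rewrite /= gset_actM. Qed.

Definition sub_gset : gset G := GSet sub_gset_act1 sub_gset_actM.

End SubGSet.

Section PermutationModule.
Variables (K : nzRingType) (G : groupType) (X : gset G).

(* The element f stands for the formal combination of the x : X with
   coefficients f x, and g sends the basis element x to the basis element g x. *)
Definition perm_act (g : G) (f : {ffun X -> K^o}) : {ffun X -> K^o} :=
  [ffun y => \sum_(x | gset_act g x == y) f x].

Lemma perm_act_lin g : linear (perm_act g).
Proof.
move=> a u v; apply/ffunP => y; rewrite !ffunE scaler_sumr -big_split /=.
by apply: eq_bigr => x _; rewrite !ffunE.
Qed.

Lemma perm_act1 f : perm_act 1%g f = f.
Proof.
apply/ffunP => y; rewrite ffunE (big_pred1 y) // => x.
by rewrite gset_act1.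
Qed.

Lemma perm_actM g h f : perm_act (g * h)%g f = perm_act g (perm_act h f).
Proof.
apply/ffunP => y; rewrite !ffunE; under [RHS]eq_bigr do rewrite ffunE.
rewrite (exchange_big_dep xpredT) //= big_mkcond /=; apply: eq_bigr => x _.
rewrite gset_actM; case: eqP => [e|ne].
  rewrite (big_pred1 (gset_act h x)) // => z /=.
  by rewrite andbC eq_sym; case: eqP => // ->; rewrite e eqxx.
rewrite big_pred0 // => z; apply/negP => /andP[/eqP e /eqP e'].
by apply: ne; rewrite e' e.
Qed.

Lemma perm_act_basis g x :
  perm_act g [ffun y => (y == x)%:R] = [ffun y => (y == gset_act g x)%:R].
Proof.
apply/ffunP => y; rewrite !ffunE big_mkcond (bigD1 x) //= big1 => [|z /negPf zx].
  by rewrite addr0 ffunE eqxx eq_sym; case: ifP.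
by rewrite ffunE zx; case: ifP.
Qed.

Definition perm_module : gmodule K G := GModule perm_act_lin perm_act1 perm_actM.

End PermutationModule.

Section QuotientModule.
Variables (K : nzRingType) (V : lmodType K) (I : submodClosed V).

(* submodClosed does not carry closure under opposites, which over a ring
   follows from closure under scaling by -1. *)
Definition submod_pred : {pred V} := [pred v | v \in I].

Lemma submod_pred_zmod : zmod_closed submod_pred.
Proof.
split=> [|u v uI vI]; first exact: rpred0.
by rewrite inE -scaleN1r rpredD ?rpredZ.
Qed.

HB.instance Definition _ := GRing.isZmodClosed.Build V submod_pred submod_pred_zmod.

Definition quotmod : Type := Quotient.quot submod_pred.

HB.instance Definition _ := GRing.Zmodule.on quotmod.
HB.instance Definition _ : EqQuotient V (Quotient.equiv submod_pred) quotmod :=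
  EqQuotient.on quotmod.

Lemma quotmod_eq (u v : V) : (\pi_quotmod u == \pi_quotmod v) = (u - v \in I).
Proof. exact: (esym (Quotient.idealrBE submod_pred u v)). Qed.

Lemma quotmodD (u v : V) : \pi_quotmod (u + v) = \pi_quotmod u + \pi_quotmod v.
Proof. exact: Quotient.pi_add. Qed.

Lemma quotmod_repr (v : V) : repr (\pi_quotmod v) - v \in I.
Proof. by rewrite -quotmod_eq reprK. Qed.

Definition quotmod_scale (a : K) (x : quotmod) : quotmod := \pi_quotmod (a *: repr x).

Lemma quotmod_scaleE a v : quotmod_scale a (\pi_quotmod v) = \pi_quotmod (a *: v).
Proof.
apply/eqP; rewrite quotmod_eq -scalerBr; exact/rpredZ/quotmod_repr.
Qed.

Lemma quotmod_scaleA a b x :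
  quotmod_scale a (quotmod_scale b x) = quotmod_scale (a * b) x.
Proof. by rewrite -[x]reprK (quotmod_scaleE b) !quotmod_scaleE scalerA. Qed.

Lemma quotmod_scale1 : left_id 1 quotmod_scale.
Proof. by move=> x; rewrite -[x]reprK !quotmod_scaleE scale1r. Qed.

Lemma quotmod_scaleDr : right_distributive quotmod_scale +%R.
Proof.
move=> a x y; rewrite -[x]reprK -[y]reprK -quotmodD !quotmod_scaleE.
by rewrite -quotmodD scalerDr.
Qed.

Lemma quotmod_scaleDl x : {morph quotmod_scale^~ x : a b / a + b}.
Proof.
move=> a b; rewrite -[x]reprK !quotmod_scaleE.
by rewrite -quotmodD scalerDl.
Qed.

HB.instance Definition _ := GRing.Zmodule_isLmodule.Build K quotmod
  quotmod_scaleA quotmod_scale1 quotmod_scaleDr quotmod_scaleDl.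

Lemma quotmodZ a (v : V) : \pi_quotmod (a *: v) = a *: \pi_quotmod v.
Proof. by rewrite -quotmod_scaleE. Qed.

End QuotientModule.

Section QuotientGModule.
Variables (K : nzRingType) (G : groupType) (V : gmodule K G).
Variable I : submodClosed V.
Hypothesis I_stable : forall g v, v \in I -> gmod_act g v \in I.

Definition quot_act (g : G) (x : quotmod I) : quotmod I :=
  \pi_(quotmod I) (gmod_act g (repr x)).

Lemma quot_actE g (v : V) :
  quot_act g (\pi_(quotmod I) v) = \pi_(quotmod I) (gmod_act g v).
Proof.
apply/eqP; rewrite quotmod_eq.
have -> : forall u w, gmod_act g u - gmod_act g w = gmod_act g (u - w) :> V.
  by move=> u w; rewrite addrC -scaleN1r -gmod_act_lin scaleN1r addrC.
exact/I_stable/quotmod_repr.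
Qed.

Lemma quot_act_lin g : linear (quot_act g).
Proof.
move=> a x y; rewrite -[x]reprK -[y]reprK -quotmodZ -quotmodD !quot_actE.
by rewrite gmod_act_lin quotmodD quotmodZ.
Qed.

Lemma quot_act1 x : quot_act 1%g x = x.
Proof. by rewrite -[x]reprK quot_actE gmod_act1. Qed.

Lemma quot_actM g h x : quot_act (g * h)%g x = quot_act g (quot_act h x).
Proof. by rewrite -[x]reprK (quot_actE h) !quot_actE gmod_actM. Qed.

Definition quot_gmodule : gmodule K G := GModule quot_act_lin quot_act1 quot_actM.

End QuotientGModule.

Section Ideal.
Variables (K : comNzRingType) (A : comAlgType K) (gens : seq A).

Definition ideal : {pred A} := fun p =>
  `[< exists c : nat -> A, p = \sum_(i < size gens) c i * gens`_i >].

Lemma idealP p : reflect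
  (exists c : nat -> A, p = \sum_(i < size gens) c i * gens`_i) (p \in ideal).
Proof. exact: asboolP. Qed.

Lemma ideal_submod_closed : submod_closed ideal.
Proof.
split=> [|a p q /idealP[c ->] /idealP[d ->]]; apply/idealP.
  by exists (fun=> 0); rewrite big1 // => i _; rewrite mul0r.
exists (fun i => a *: c i + d i); rewrite scaler_sumr -big_split /=.
by apply: eq_bigr => i _; rewrite mulrDl scalerAl.
Qed.

HB.instance Definition _ :=
  GRing.isSubmodClosed.Build K A ideal ideal_submod_closed.

Lemma ideal_gen p : p \in gens -> p \in ideal.
Proof.
move=> pg; apply/idealP; exists (fun i => (i == index p gens)%:R).
have lt_p : (index p gens < size gens)%N by rewrite index_mem.
rewrite (bigD1 (Ordinal lt_p)) //= eqxx mul1r nth_index // big1 ?addr0 //.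
by move=> i; rewrite -val_eqE /= => /negPf ->; rewrite mul0r.
Qed.

Lemma ideal_mul p q : q \in ideal -> p * q \in ideal.
Proof.
move=> /idealP[c ->]; apply/idealP; exists (fun i => p * c i).
by rewrite mulr_sumr; apply: eq_bigr => i _; rewrite mulrA.
Qed.

End Ideal.

(* The complex numbers are R[i] for an arbitrary model R of the reals. *)
Section Zeta.
Variable R : realType.
Local Notation C := R[i].

Definition zeta (r : nat) : C :=
  (cos (pi *+ 2 / r%:R) +i* sin (pi *+ 2 / r%:R))%C.

Lemma zetaX r m : zeta r ^+ m =
  (cos (pi *+ 2 / r%:R *+ m) +i* sin (pi *+ 2 / r%:R *+ m))%C.
Proof.
elim: m => [|m IH]; first by rewrite expr0 mulr0n cos0 sin0.
rewrite exprS IH [_ *+ m.+1]mulrS cosD sinD /zeta; apply/eqP.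
by rewrite eq_complex /= eqxx addrC eqxx.
Qed.

Lemma zeta_prim r : (0 < r)%N -> r.-primitive_root (zeta r).
Proof.
move=> r_gt0; have r0 : r%:R != 0 :> R by rewrite pnatr_eq0 -lt0n.
have zr : zeta r ^+ r = 1.
  by rewrite zetaX -mulr_natr divfK // cos2pi sin2pi.
have zn m : (0 < m < r)%N -> zeta r ^+ m != 1.
  case/andP=> m_gt0 lt_mr; apply/eqP; rewrite zetaX => -[cm _].
  have : 0 < sin (pi / r%:R *+ m : R).
    apply: sin_gt0_pi; rewrite -mulr_natr mulrAC.
    rewrite divr_gt0 ?mulr_gt0 ?pi_gt0 ?ltr0n //=.
    by rewrite ltr_pdivrMr ?ltr0n // ltr_pM2l ?pi_gt0 // ltr_nat.
  move: cm; rewrite mulrnAl mulrnAC cos_mulr2n => /eqP.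
  rewrite subr_eq -mulr2n -subr_eq0 -mulrnBl mulrn_eq0 /=.
  rewrite -oppr_eq0 opprB -sin2cos2 sqrf_eq0 => /eqP ->.
  by rewrite ltxx.
apply/andP; split=> //; apply/forallP => i; rewrite unity_rootE; apply/eqP.
case: (ltngtP i.+1 r) => [lt_ir||->]; last by rewrite zr eqxx.
  by rewrite (negPf (zn i.+1 _)) ?lt_ir.
by move=> lt_ri; have := leq_trans lt_ri (ltn_ord i); rewrite ltnn.
Qed.

End Zeta.

Section MonomialMatrices.
Variables (R : realType) (r n : nat).
Local Notation C := R[i].

Definition monomial_mx (A : 'M[C]_n) : bool :=
  [forall i, #|[pred j | A i j != 0]| == 1%N] &&
  [forall j, #|[pred i | A i j != 0]| == 1%N].

Definition root_monomial_mx (A : 'M[C]_n) : bool :=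
  monomial_mx A && [forall i, forall j, (A i j != 0) ==> (A i j ^+ r == 1)].

Record Gn := MkGn { Gn_mx :> 'M[C]_n; Gn_mxP : root_monomial_mx Gn_mx }.

HB.instance Definition _ := [isSub for Gn_mx].
HB.instance Definition _ := [Choice of Gn by <:].

Definition mono_mx (s : 'S_n) (g : 'I_n -> C) : 'M[C]_n :=
  \matrix_(i, l) (if i == s l then g l else 0).

Definition Gn_fun (A : Gn) (l : 'I_n) : 'I_n := odflt l [pick i | A i l != 0].

Lemma Gn_funP (A : Gn) i l : (A i l != 0) = (i == Gn_fun A l).
Proof.
have /andP[/andP[_ /forallP/(_ l)/eqP]] := Gn_mxP A.
move=> /mem_card1[k kP] _.
have AE j : (A j l != 0) = (j == k) by have := kP j; rewrite !inE.
rewrite /Gn_fun; case: pickP => [j|/(_ k)]; rewrite AE ?eqxx //.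
by move=> /eqP ->; rewrite AE.
Qed.

Lemma Gn_fun_inj (A : Gn) : injective (Gn_fun A).
Proof.
move=> l m lm.
have /andP[/andP[/forallP/(_ (Gn_fun A l))/eqP + _] _] := Gn_mxP A.
move=> /mem_card1[k kP].
have AE j : (A (Gn_fun A l) j != 0) = (j == k) by have := kP j; rewrite !inE.
have := AE l; have := AE m; rewrite !Gn_funP lm eqxx.
by move=> /esym/eqP -> /esym/eqP ->.
Qed.

(* A = pi diag(g_1, ..., g_n) with pi = Gn_perm A and g = Gn_val A, where the
   matrix of pi sends the l-th basis column to the pi_l-th one; Gn_permM and
   Gn_valM check that this is compatible with the product. *)
Definition Gn_perm (A : Gn) : 'S_n := perm (@Gn_fun_inj A).
Definition Gn_val (A : Gn) (l : 'I_n) : C := A (Gn_perm A l) l.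

Lemma Gn_val_neq0 A l : Gn_val A l != 0.
Proof. by rewrite /Gn_val Gn_funP permE. Qed.

Lemma Gn_valX A l : Gn_val A l ^+ r = 1.
Proof.
have /andP[_ /forallP/(_ (Gn_perm A l))/forallP/(_ l)] := Gn_mxP A.
by move/implyP/(_ (Gn_val_neq0 A l))/eqP.
Qed.

Lemma Gn_mxE A : Gn_mx A = mono_mx (Gn_perm A) (Gn_val A).
Proof.
apply/matrixP => i l; rewrite mxE permE; case: eqP => [->|/eqP].
  by rewrite /Gn_val permE.
by rewrite -Gn_funP negbK => /eqP.
Qed.

Lemma mono_mxP s g : (forall l, g l != 0) -> (forall l, g l ^+ r = 1) ->
  root_monomial_mx (mono_mx s g).
Proof.
move=> g0 gr; have E i l : (mono_mx s g i l != 0) = (i == s l).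
  by rewrite mxE; case: ifP; rewrite ?eqxx ?g0.
apply/andP; split; [apply/andP; split|]; apply/forallP => i.
- rewrite -(card1 (s^-1%g i)); apply/eqP/eq_card => l; rewrite !inE E.
  by rewrite eq_sym -(inj_eq (@perm_inj _ s) l) permKV.
- by rewrite -(card1 (s i)); apply/eqP/eq_card => l; rewrite !inE E.
by apply/forallP => l; apply/implyP; rewrite E mxE => ->; rewrite gr.
Qed.

Lemma mono_mx_inj s t g h : (forall l, g l != 0) -> mono_mx s g = mono_mx t h ->
  s = t /\ g =1 h.
Proof.
move=> g0 /matrixP E.
have st : s = t.
  apply/permP => l; have := E (s l) l; rewrite !mxE eqxx.
  by case: eqP => // _ gl0; have := g0 l; rewrite gl0 eqxx.
by split=> // l; have := E (s l) l; rewrite !mxE -st eqxx.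
Qed.

Lemma Gn_mono s g (A : Gn) : (forall l, g l != 0) ->
  Gn_mx A = mono_mx s g -> Gn_perm A = s /\ Gn_val A =1 g.
Proof. by move=> g0; rewrite Gn_mxE; apply/mono_mx_inj/Gn_val_neq0. Qed.

Lemma mono_mxM s t g h :
  mono_mx s g *m mono_mx t h = mono_mx (t * s)%g (fun l => g (t l) * h l).
Proof.
apply/matrixP => i l; rewrite !mxE (bigD1 (t l)) //= big1 => [|j /negPf jt].
  by rewrite !mxE eqxx permM addr0; case: ifP; rewrite ?mul0r.
by rewrite [X in _ * X]mxE jt mulr0.
Qed.

Lemma Gn_mulP (A B : Gn) : root_monomial_mx (A *m B).
Proof.
rewrite !Gn_mxE mono_mxM; apply: mono_mxP => l.
  by rewrite mulf_neq0 ?Gn_val_neq0.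
by rewrite exprMn !Gn_valX mulr1.
Qed.

Lemma mono_mx1 : mono_mx 1 (fun=> 1) = 1%:M.
Proof.
by apply/matrixP => i l; rewrite !mxE perm1; case: eqP.
Qed.

Lemma Gn_oneP : root_monomial_mx 1%:M.
Proof.
by rewrite -mono_mx1; apply: mono_mxP => l; rewrite ?oner_neq0 ?expr1n.
Qed.

Lemma Gn_invE (A : Gn) : invmx A =
  mono_mx (Gn_perm A)^-1 (fun l => (Gn_val A ((Gn_perm A)^-1%g l))^-1).
Proof.
have E : mono_mx (Gn_perm A)^-1
    (fun l => (Gn_val A ((Gn_perm A)^-1%g l))^-1) *m A = 1%:M.
  rewrite Gn_mxE mono_mxM mulgV -mono_mx1; apply/matrixP => i l.
  by rewrite !mxE permK mulVf ?Gn_val_neq0.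
have uA : (A : 'M[C]_n) \in unitmx by case/mulmx1_unit: E.
by rewrite -[RHS]mulmx1 -(mulmxV uA) mulmxA E mul1mx.
Qed.

Lemma Gn_invP (A : Gn) : root_monomial_mx (invmx A).
Proof.
rewrite Gn_invE; apply: mono_mxP => l; first by rewrite invr_eq0 Gn_val_neq0.
by rewrite exprVn Gn_valX invr1.
Qed.

Lemma Gn_unit (A : Gn) : (A : 'M[C]_n) \in unitmx.
Proof.
rewrite unitmxE unitfE; apply/negP => /eqP dA.
have : \det (invmx A *m A) == 1 :> C.
  rewrite Gn_invE Gn_mxE mono_mxM mulgV.
  rewrite (_ : mono_mx _ _ = 1%:M) ?det1 // -mono_mx1.
  by apply/matrixP => i l; rewrite !mxE permK mulVf ?Gn_val_neq0.
by rewrite det_mulmx dA mulr0 eq_sym oner_eq0.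
Qed.

Definition Gn_one : Gn := MkGn Gn_oneP.
Definition Gn_mul (A B : Gn) : Gn := MkGn (Gn_mulP A B).
Definition Gn_inv (A : Gn) : Gn := MkGn (Gn_invP A).

Lemma Gn_mulA : associative Gn_mul.
Proof. by move=> A B D; apply/val_inj/mulmxA. Qed.
Lemma Gn_mul1 : left_id Gn_one Gn_mul.
Proof. by move=> A; apply/val_inj/mul1mx. Qed.
Lemma Gn_mulr1 : right_id Gn_one Gn_mul.
Proof. by move=> A; apply/val_inj/mulmx1. Qed.
Lemma Gn_mulV : left_inverse Gn_one Gn_inv Gn_mul.
Proof. by move=> A; apply/val_inj/mulVmx/Gn_unit. Qed.
Lemma Gn_mulrV : right_inverse Gn_one Gn_inv Gn_mul.
Proof. by move=> A; apply/val_inj/mulmxV/Gn_unit. Qed.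

HB.instance Definition _ := isGroup.Build Gn
  Gn_mulA Gn_mul1 Gn_mulr1 Gn_mulV Gn_mulrV.

Lemma Gn_perm1 : Gn_perm 1%g = 1%g.
Proof.
have [l||//] := @Gn_mono 1%g (fun=> 1) 1%g; first exact: oner_neq0.
by rewrite mono_mx1.
Qed.

Lemma Gn_val1 l : Gn_val 1%g l = 1.
Proof. by rewrite /Gn_val Gn_perm1 perm1 mxE eqxx. Qed.

Lemma Gn_permM (A B : Gn) : Gn_perm (A * B)%g = (Gn_perm B * Gn_perm A)%g.
Proof.
have [||->//] := @Gn_mono (Gn_perm B * Gn_perm A)%g
  (fun l => Gn_val A (Gn_perm B l) * Gn_val B l) (A * B)%g.
  by move=> l; rewrite mulf_neq0 ?Gn_val_neq0.
by rewrite -mono_mxM -!Gn_mxE.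
Qed.

Lemma Gn_valM (A B : Gn) l :
  Gn_val (A * B)%g l = Gn_val A (Gn_perm B l) * Gn_val B l.
Proof.
have [||_ -> //] := @Gn_mono (Gn_perm B * Gn_perm A)%g
  (fun l => Gn_val A (Gn_perm B l) * Gn_val B l) (A * B)%g.
  by move=> k; rewrite mulf_neq0 ?Gn_val_neq0.
by rewrite -mono_mxM -!Gn_mxE.
Qed.

(* The c in {0, ..., r-1} with g_l = zeta^c, where A = pi diag(g_1, ..., g_n). *)
Definition Gn_color (A : Gn) (l : 'I_n) : nat :=
  oapp val 0%N [pick c : 'I_r | zeta R r ^+ c == Gn_val A l].

Lemma Gn_colorE (A : Gn) l : (0 < r)%N -> zeta R r ^+ Gn_color A l = Gn_val A l.
Proof.
move=> /(zeta_prim R) zP; rewrite /Gn_color.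
case: pickP => [c /eqP|no] //=.
have [c cE] := prim_rootP zP (Gn_valX A l).
by have := no c; rewrite cE eqxx.
Qed.

Lemma Gn_color1 l : (0 < r)%N -> (Gn_color 1%g l = 0 %[mod r])%N.
Proof.
move=> r0; apply/eqP; rewrite -(eq_prim_root_expr (zeta_prim R r0)).
by rewrite Gn_colorE // Gn_val1.
Qed.

Lemma Gn_colorM (A B : Gn) l : (0 < r)%N ->
  (Gn_color (A * B)%g l = Gn_color A (Gn_perm B l) + Gn_color B l %[mod r])%N.
Proof.
move=> r0; apply/eqP; rewrite -(eq_prim_root_expr (zeta_prim R r0)).
by rewrite exprD !Gn_colorE // Gn_valM.
Qed.

End MonomialMatrices.

Section Polynomials.
Variables (R : realType) (r n : nat).
Local Notation C := R[i].
Local Notation Gn := (Gn R r n).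

(* For A = pi diag(g_1, ..., g_n), A.x_l = pi.(g_l^-1 x_l) = g_l^-1 x_(pi l). *)
Definition poly_act (A : Gn) (p : {mpoly C[n]}) : {mpoly C[n]} :=
  p \mPo [tuple (Gn_val A l)^-1 *: 'X_(Gn_perm A l) | l < n].

Lemma poly_actX A l : poly_act A 'X_l = (Gn_val A l)^-1 *: 'X_(Gn_perm A l).
Proof. by rewrite /poly_act comp_mpolyXU -tnth_nth tnth_mktuple. Qed.

Lemma poly_actE A p :
  poly_act A p = \sum_(m <- msupp p) p@_m *: poly_act A 'X_[m].
Proof. exact: comp_mpolyEX. Qed.

Lemma poly_act_lin A : linear (poly_act A).
Proof. exact: linearP. Qed.

Lemma poly_act_monoid A : monoid_morphism (poly_act A).
Proof. by split=> [|p q]; rewrite /poly_act ?rmorph1 ?rmorphM. Qed.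

HB.instance Definition _ A := GRing.isLinear.Build C {mpoly C[n]} {mpoly C[n]} _
  (poly_act A) (poly_act_lin A).
HB.instance Definition _ A := GRing.isMonoidMorphism.Build
  {mpoly C[n]} {mpoly C[n]} (poly_act A) (poly_act_monoid A).

Lemma poly_act1 p : poly_act 1%g p = p.
Proof.
rewrite /poly_act; set t := [tuple _ | l < n].
have -> : t = [tuple 'X_l | l < n]; last exact: comp_mpoly_id.
apply: eq_from_tnth => l; rewrite !tnth_mktuple.
by rewrite Gn_val1 Gn_perm1 perm1 invr1 scale1r.
Qed.

Lemma poly_actM A B p : poly_act (A * B)%g p = poly_act A (poly_act B p).
Proof.
have E m : poly_act (A * B)%g 'X_[m] = poly_act A (poly_act B 'X_[m]).
  rewrite /poly_act !comp_mpolyX rmorph_prod; apply: eq_bigr => l _.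
  rewrite rmorphXn /= !tnth_mktuple comp_mpolyZ -/(poly_act A _) poly_actX.
  by rewrite scalerA Gn_valM Gn_permM permM invfM mulrC.
rewrite (poly_actE B) linear_sum poly_actE.
by apply: eq_bigr => m _; rewrite linearZ /= E.
Qed.

Definition poly_gmodule : gmodule C Gn :=
  @GModule C Gn {mpoly C[n]} poly_act poly_act_lin poly_act1 poly_actM.

Definition elem_sym_pow (d : nat) : {mpoly C[n]} :=
  mesym n C d \mPo [tuple 'X_i ^+ r | i < n].

Lemma poly_act_elem A d : poly_act A (elem_sym_pow d) = elem_sym_pow d.
Proof.
have {2}-> : elem_sym_pow d =
    mesym n C d \mPo [tuple 'X_(Gn_perm A i) ^+ r | i < n].
  rewrite /elem_sym_pow -{1}[mesym n C d](issymP _ (mesym_sym n C d) (Gn_perm A)).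
  rewrite msym_mPo; set t := [tuple _ | i < n]; set u := [tuple _ | i < n].
  by have -> // : t = u; apply: eq_from_tnth => l; rewrite !tnth_mktuple.
have E m : poly_act A ('X_[m] \mPo [tuple 'X_i ^+ r | i < n]) =
    'X_[m] \mPo [tuple 'X_(Gn_perm A i) ^+ r | i < n].
  rewrite !comp_mpolyX rmorph_prod; apply: eq_bigr => l _.
  rewrite rmorphXn /= !tnth_mktuple rmorphXn /= poly_actX.
  by rewrite exprZn exprVn Gn_valX invr1 scale1r.
rewrite /elem_sym_pow comp_mpolyEX linear_sum [RHS]comp_mpolyEX.
by apply: eq_bigr => m _; rewrite linearZ /= E.
Qed.

(* x_1^m, ..., x_n^m, e_n(x^r), ..., e_(n-k+1)(x^r) *)
Definition power_gens (m k : nat) : seq {mpoly C[n]} :=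
  [seq 'X_i ^+ m | i <- enum 'I_n] ++ [seq elem_sym_pow (n - j) | j <- iota 0 k].

Lemma power_ideal_stable m k (A : Gn) (p : poly_gmodule) :
  p \in ideal (power_gens m k) ->
  @gmod_act _ _ poly_gmodule A p \in ideal (power_gens m k).
Proof.
move=> /idealP[c ->]; rewrite /= /poly_act raddf_sum /=; apply: rpred_sum => i _.
rewrite rmorphM /=; apply: ideal_mul; rewrite -/(poly_act A _).
have := mem_nth 0 (ltn_ord i); move: (_`_i) => q.
rewrite mem_cat => /orP[] /mapP[j jP ->].
  rewrite /poly_act rmorphXn /= -/(poly_act A _) poly_actX exprZn.
  apply/rpredZ/ideal_gen; rewrite mem_cat; apply/orP; left.
  by apply: map_f; rewrite mem_enum.
rewrite poly_act_elem; apply: ideal_gen; rewrite mem_cat; apply/orP; right.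
by apply/mapP; exists j.
Qed.

Definition I_gens (k : nat) := power_gens (k * r).+1 k.
Definition J_gens (k : nat) := power_gens (k * r) k.

Definition R_module (k : nat) : gmodule C Gn :=
  @quot_gmodule C Gn poly_gmodule (ideal (I_gens k)) (@power_ideal_stable _ k).

Definition S_module (k : nat) : gmodule C Gn :=
  @quot_gmodule C Gn poly_gmodule (ideal (J_gens k)) (@power_ideal_stable _ k).

End Polynomials.

Section Faces.
Variables (R : realType) (r n : nat).
Local Notation Gn := (Gn R r n).

(* The sequence of blocks (at most n of them, being nonempty and disjoint),
   and the color of each letter, None for an uncolored letter. *)
Definition colored_blocks : finType :=
  (n.-bseq {set 'I_n} * {ffun 'I_n -> option 'I_r})%type.

Implicit Types (s : colored_blocks) (A B : Gn).

Definition blocks s : seq {set 'I_n} := s.1.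
Definition color s : {ffun 'I_n -> option 'I_r} := s.2.
Definition first_block s : {set 'I_n} := head set0 (blocks s).

Definition is_face s : bool :=
  [&& uniq (blocks s), partition [set X in blocks s] [set: 'I_n],
      [forall i, (i \notin first_block s) ==> (color s i != None)] &
      [forall i in first_block s, color s i != None] ||
      [forall i in first_block s, color s i == None]].

Definition has_zero_block s : bool :=
  (blocks s != [::]) && [forall i in first_block s, color s i == None].

Definition face_dim s : nat := size (blocks s) - has_zero_block s.

Definition is_F (k : nat) s : bool := is_face s && (face_dim s == k).
Definition is_OP (k : nat) s : bool := is_F k s && ~~ has_zero_block s.

Definition shift_color (c : nat) (a : 'I_r) : 'I_r :=
  Ordinal (ltn_pmod (a + c) (leq_ltn_trans (leq0n a) (ltn_ord a))).

Fact act_blocks_size A s :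
  (size [seq Gn_perm A @: X | X : {set 'I_n} <- blocks s] <= n)%N.
Proof. by rewrite size_map size_bseq. Qed.

(* For A = pi diag(zeta^c_1, ..., zeta^c_n), the letter pi_i of A.s carries the
   color of the letter i of s, increased by c_i. *)
Definition blocks_act A s : colored_blocks :=
  (Bseq (act_blocks_size A s),
   [ffun j => let i := (Gn_perm A)^-1%g j in
              omap (shift_color (Gn_color A i)) (color s i)]).

Lemma shift_color_eq c d a : (c = d %[mod r])%N -> shift_color c a = shift_color d a.
Proof. by move=> cd; apply: val_inj => /=; rewrite -modnDmr cd modnDmr. Qed.

Lemma blocks_act1 s : blocks_act 1%g s = s.
Proof.
case: s => -[b sb] f; congr (_, _).
  apply: val_inj; rewrite /= -[RHS]map_id; apply: eq_map => X.
  rewrite Gn_perm1 -[RHS]imset_id; apply: eq_imset => i; exact: perm1.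
apply/ffunP => i; rewrite ffunE /= Gn_perm1 invg1 perm1.
rewrite /color /=; case: (f i) => //= a; have r0 : (0 < r)%N by case: r a => [[]|].
congr Some; rewrite (@shift_color_eq _ 0) ?Gn_color1 //.
by apply: val_inj; rewrite /= addn0 modn_small.
Qed.

Lemma blocks_actM A B s : blocks_act (A * B)%g s = blocks_act A (blocks_act B s).
Proof.
congr (_, _).
  apply: val_inj; rewrite /= /blocks /= -map_comp; apply: eq_map => X /=.
  by rewrite -imset_comp; apply: eq_imset => i; rewrite Gn_permM permM.
apply/ffunP => j; rewrite !ffunE /= Gn_permM invMg permM.
set i := ((Gn_perm B)^-1%g _); rewrite {1 2}/color /= ffunE -/i.
case: (color s i) => //= a; have r0 : (0 < r)%N by case: r a => [[]|].
congr Some; rewrite (@shift_color_eq _ _ a (Gn_colorM A B i r0)).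
apply: val_inj; rewrite /= /i permKV modnDml addnAC addnA.
by [].
Qed.

Definition blocks_gset : gset Gn := GSet blocks_act1 blocks_actM.

Lemma first_block_act A s :
  first_block (blocks_act A s) = Gn_perm A @: first_block s.
Proof.
by case: s => -[[|X b] sb] f; rewrite /first_block /blocks //= imset0.
Qed.

Lemma color_act_None A s i :
  (color (blocks_act A s) (Gn_perm A i) == None) = (color s i == None).
Proof. by rewrite ffunE permK /=; case: (color s i). Qed.

Lemma forall_act A (P Q : pred 'I_n) :
  (forall i, Q (Gn_perm A i) = P i) -> [forall i, Q i] = [forall i, P i].
Proof.
move=> PQ; apply/forallP/forallP => H i; first by rewrite -PQ.
by rewrite -(permKV (Gn_perm A) i) PQ.
Qed.

Lemma has_zero_block_act A s : has_zero_block (blocks_act A s) = has_zero_block s.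
Proof.
congr (_ && _); first by case: s => -[[|X b] sb] f.
apply: (forall_act (A := A)) => i.
by rewrite first_block_act mem_imset ?color_act_None //; apply: perm_inj.
Qed.

Lemma face_dim_act A s : face_dim (blocks_act A s) = face_dim s.
Proof. by rewrite /face_dim has_zero_block_act /blocks /= size_map. Qed.

Lemma is_face_act A s : is_face s -> is_face (blocks_act A s).
Proof.
have mI : {mono (fun X : {set 'I_n} => Gn_perm A @: X) : X Y / X == Y}.
  exact/inj_eq/imset_inj/perm_inj.
have mf (i : 'I_n) : (Gn_perm A i \in first_block (blocks_act A s)) =
    (i \in first_block s).
  by rewrite first_block_act mem_imset //; apply: perm_inj.
case/and4P=> us ps cs fs; apply/and4P; split.
- by rewrite /blocks /= map_inj_uniq //; apply/imset_inj/perm_inj.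
- case/and3P: ps => /eqP cov triv no0; apply/and3P; split.
  + rewrite -subTset; apply/subsetP => j _; apply/bigcupP.
    have : (Gn_perm A)^-1%g j \in cover [set X in blocks s] by rewrite cov.
    case/bigcupP=> X; rewrite inE => Xs jX; exists (Gn_perm A @: X).
      by rewrite inE; apply: map_f.
    by apply/imsetP; exists ((Gn_perm A)^-1%g j); rewrite // permKV.
  + apply/trivIsetP => X Y; rewrite !inE => /mapP[X' X's ->] /mapP[Y' Y's ->].
    rewrite (inj_eq (imset_inj (@perm_inj _ _))) => ne.
    rewrite imset_disjoint ?(trivIsetP triv) ?inE //.
    exact: perm_inj.
  + rewrite inE; apply/mapP => -[X Xs /esym/eqP]; rewrite imset_eq0 => /eqP X0.
    by move: no0; rewrite inE -X0 Xs.
- rewrite (forall_act (A := A) (P := fun i => (i \notin first_block s) ==>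
    (color s i != None))) // => i.
  by rewrite mf color_act_None.
case/orP: fs => fs; apply/orP; [left|right].
  rewrite (forall_act (A := A) (P := fun i => (i \in first_block s) ==>
    (color s i != None))) // => i.
  by rewrite mf color_act_None.
rewrite (forall_act (A := A) (P := fun i => (i \in first_block s) ==>
  (color s i == None))) // => i.
by rewrite mf color_act_None.
Qed.

Lemma is_F_act k A (s : blocks_gset) : is_F k s -> is_F k (gset_act A s).
Proof.
by case/andP=> fs ds; rewrite /is_F is_face_act //= face_dim_act.
Qed.

Lemma is_OP_act k A (s : blocks_gset) : is_OP k s -> is_OP k (gset_act A s).
Proof.
by case/andP=> fs zs; rewrite /is_OP is_F_act //= has_zero_block_act.
Qed.

Definition F_gset (k : nat) : gset Gn := sub_gset (@is_F_act k).
Definition OP_gset (k : nat) : gset Gn := sub_gset (@is_OP_act k).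

End Faces.

(* Main.v *)
Require Import Defs.
From HB Require Import structures.
From mathcomp Require Import all_boot all_order all_algebra fingroup perm.
From mathcomp Require Import generic_quotient.
From mathcomp Require Import complex mpoly zify ring.
From mathcomp Require Import boolp reals.

(** Let z be 1 for R_(n,k) and 0 for S_(n,k), let a = kr + z, and let I be the
    ideal generated by the x_i^a and by e_n(x^r), ..., e_(n-k+1)(x^r). Send a
    face to the point of C^n whose i-th coordinate is (j+1) zeta^c if the letter
    i has color c and lies in the nonzero block number j (from 0), and 0 if i
    lies in the zero block. This is injective and equivariant, so the functions
    on the resulting finite set Y of points form the permutation module of the
    faces, and evaluation maps the polynomials onto them (Lagrange
    interpolation). The quotient by I is a degeneration of this module.

    Lower bound. Every generator of I is the top degree part of a polynomial
    that vanishes on Y. For x_i^a it is x_i^z prod_j (x_i^r - (j+1)^r). For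
    e_(n-j)(x^r), which is the coefficient of T^j in prod_i (T + x_i^r), it is
    the coefficient of T^j in the remainder of that product modulo
    prod_(j < k) (T + (j+1)^r): the remainder vanishes at a point of Y because
    each (j+1)^r is the r-th power of some coordinate. Hence a homogeneous
    element of I agrees on Y with a polynomial of smaller degree
    ([lower_power_top], [lower_elem_sym_top], [ideal_lower_degree]).

    Upper bound. Replace k by any number s of low coefficients of
    prod_i (T + x_i^r), next to the x_i^a, and filter by the powers x^j of the
    last variable x. The layer of x^j is a quotient of the polynomials in one
    variable less by the analogous ideal with s - 1 coefficients if j < rs, and
    with s coefficients otherwise. This recursion produces monomials which span
    the quotient by I ([std_monomials_span]). The words in a letters among which
    s given classes of r letters must all be represented obey the same
    recursion, according to their first letter ([count_hits]), and for s = k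
    these words encode the faces ([card_faces]).

    Conclusion. The monomials found span the functions on Y and there are no
    more of them than points, so they are a basis both of these functions and of
    the quotient by I. The projection of the polynomials along I onto their span
    does not raise degrees; its average over the finite group G_n has the same
    property and is equivariant, and following it by evaluation on Y induces the
    isomorphism ([quot_iso_of_deformation]). *)

Set Implicit Arguments.
Unset Strict Implicit.
Unset Printing Implicit Defensive.

Import GRing.Theory Num.Theory Order.TTheory.
Import Pdiv.Field.

Local Open Scope ring_scope.
Local Open Scope quotient_scope.

(** * Finite families in vector spaces *)

Section Families.
Variables (K : fieldType) (V : lmodType K) (N : nat) (u : 'I_N -> V).

Definition spans := forall v, exists c : 'I_N -> K, v = \sum_i c i *: u i.

Definition independent :=
  forall c : 'I_N -> K, \sum_i c i *: u i = 0 -> forall i, c i = 0.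

Lemma independent_inj c d : independent ->
  \sum_i c i *: u i = \sum_i d i *: u i -> c =1 d.
Proof.
move=> u_indep cd i; apply/eqP; rewrite -subr_eq0; apply/eqP.
apply: (u_indep (fun i => c i - d i)); under eq_bigr do rewrite scalerBl.
by rewrite sumrB cd subrr.
Qed.

End Families.

(** The values of the family form a matrix of full column rank with at most as
    many rows as columns, so its rows are free as well. *)
Lemma spans_independent (K : fieldType) (T : finType) (N : nat)
    (u : 'I_N -> {ffun T -> K^o}) :
  (N <= #|T|)%N -> spans u -> independent u.
Proof.
move=> leN u_span c c0.
pose M : 'M[K]_(N, #|T|) := \matrix_(i, j) u i (enum_val j).
have combM (d : 'I_N -> K) j :
    ((\row_i d i) *m M) 0 j = (\sum_i d i *: u i) (enum_val j).
  rewrite mxE sum_ffunE; apply: eq_bigr => i _.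
  by rewrite !mxE ffunE.
have fullM : row_full M.
  apply/row_fullP.
  have [d dP] := choice (fun t : 'I_#|T| =>
    u_span (finfun (fun x => (x == enum_val t)%:R : K^o))).
  exists (\matrix_(t, i) d t i); apply/row_matrixP => t.
  rewrite row_mul (_ : row t _ = \row_i d t i); last first.
    by apply/rowP => i; rewrite !mxE.
  apply/rowP => j; rewrite combM -dP ffunE !mxE (inj_eq enum_val_inj).
  by rewrite eq_sym.
have freeM : row_free M.
  rewrite /row_free eqn_leq rank_leq_row.
  by move: fullM; rewrite /row_full => /eqP ->.
have /eqP : (\row_i c i) *m M = 0.
  by apply/rowP => j; rewrite combM c0 ffunE mxE.
rewrite mulmx_free_eq0 // => /eqP/rowP c00 i.
by have := c00 i; rewrite !mxE.
Qed.

(** * Comparing a module with its deformation *)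

HB.instance Definition _ (K : nzRingType) (G : groupType) (V : gmodule K G) g :=
  GRing.isLinear.Build K V V _ (@gmod_act K G V g) (gmod_act_lin g).

(** [V] is the ambient space, with a degree; [ev] maps it onto the module [W].
    The hypothesis [I_top] expresses that the top degree part of an element of
    [I] is also that of an element of the kernel of [ev]: subtracting the latter
    lowers the degree and keeps the image. The family [b] spans [V] modulo [I]
    degree by degree, and [W_dim] says, in a form that needs no dimension, that
    [W] has dimension at least [N]. *)
Section Comparison.
Variables (K : numFieldType) (G : groupType) (V W : gmodule K G).
Variables (I : submodClosed V) (ev : {linear V -> W}) (deg : V -> nat).
Variables (N : nat) (b : 'I_N -> V) (e : seq G).
Hypothesis I_stable : forall g v, v \in I -> gmod_act g v \in I.
Hypothesis evJ : forall g v, ev (gmod_act g v) = gmod_act g (ev v).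
Hypothesis ev_onto : forall w, exists v, ev v = w.
Hypothesis deg0 : deg 0 = 0%N.
Hypothesis deg_eq0 : forall v, deg v = 0%N -> v = 0.
Hypothesis degD : forall u v, (deg (u + v) <= maxn (deg u) (deg v))%N.
Hypothesis degZ : forall a v, (deg (a *: v) <= deg v)%N.
Hypothesis degJ : forall g v, (deg (gmod_act g v) <= deg v)%N.
Hypothesis I_top : forall d v, v \in I -> (deg v <= d.+1)%N ->
  exists2 v', (deg v' <= d)%N & ev v = ev v'.
Hypothesis b_span : forall d v, (deg v <= d)%N -> exists2 c : 'I_N -> K,
  v - \sum_i c i *: b i \in I & forall i, c i != 0 -> (deg (b i) <= d)%N.
Hypothesis W_dim : forall u : 'I_N -> W, spans u -> independent u.
Hypothesis e_uniq : uniq e.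
Hypothesis e_full : forall g, g \in e.

Let deg_sum (T : Type) (s : seq T) (P : pred T) (F : T -> V) d :
  (forall i, P i -> (deg (F i) <= d)%N) ->
  (deg (\sum_(i <- s | P i) F i) <= d)%N.
Proof.
move=> FP; apply: (big_ind (fun v => (deg v <= d)%N)) => //; first by rewrite deg0.
by move=> u v ud vd; apply: leq_trans (degD u v) _; rewrite geq_max ud vd.
Qed.

Let deg_comb (c : 'I_N -> K) d : (forall i, c i != 0 -> (deg (b i) <= d)%N) ->
  (deg (\sum_i c i *: b i) <= d)%N.
Proof.
move=> cP; apply: deg_sum => i _; have [->|/cP] := eqVneq (c i) 0.
  by rewrite scale0r deg0.
exact/leq_trans/degZ.
Qed.

Let degB u v d : (deg u <= d)%N -> (deg v <= d)%N -> (deg (u - v) <= d)%N.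
Proof.
move=> ud vd; apply: leq_trans (degD _ _) _; rewrite geq_max ud -scaleN1r.
exact: leq_trans (degZ _ _) vd.
Qed.

(** Up to a combination of the [b i], [v] lies in [I], where its degree can be
    lowered without changing its image. *)
Let ev_b_deg d v : (deg v <= d)%N -> exists2 c : 'I_N -> K,
  ev v = \sum_i c i *: ev (b i) & forall i, c i != 0 -> (deg (b i) <= d)%N.
Proof.
elim: d v => [|d IHd] v.
  rewrite leqn0 => /eqP/deg_eq0 ->; exists (fun=> 0) => [|i]; last by rewrite eqxx.
  by rewrite linear0 big1 // => i _; rewrite scale0r.
move=> vd; have [c vI cP] := b_span vd.
have [w wd ew] := I_top vI (degB vd (deg_comb cP)).
have [c' c'E c'P] := IHd w wd.
exists (fun i => c i + c' i).
  under eq_bigr do rewrite scalerDl.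
  rewrite big_split /= -c'E -ew linearB linear_sum /=.
  under [X in _ = _ + (_ - X)]eq_bigr do rewrite linearZ.
  by rewrite addrC subrK.
move=> i; have [->|/cP //] := eqVneq (c i) 0.
by rewrite add0r => /c'P/leq_trans; apply.
Qed.

Let ev_b_span : spans (ev \o b).
Proof.
move=> w; have [v <-] := ev_onto w.
by have [c] := ev_b_deg (leqnn (deg v)); exists c.
Qed.

Let ev_b_inj := W_dim ev_b_span.

(** A relation modulo [I] among the [b i] has, in its top degree [d], the same
    image as something of degree below [d], hence as a combination of the
    [b i] of degree below [d]: independence of the [ev (b i)] then forbids the
    terms of degree [d]. *)
Lemma b_independent_mod (c : 'I_N -> K) :
  \sum_i c i *: b i \in I -> forall i, c i = 0.
Proof.
have ev_comb : ev (\sum_i c i *: b i) = \sum_i c i *: ev (b i).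
  by rewrite linear_sum; apply: eq_bigr => i _; rewrite linearZ.
move=> cI; have [d cP] : exists d, forall i, c i != 0 -> (deg (b i) <= d)%N.
  by exists (\max_j deg (b j))%N => i _; apply: leq_bigmax.
elim: d cP => [|d IHd] cP.
  apply: ev_b_inj; rewrite /= -ev_comb.
  have := deg_comb cP; rewrite leqn0 => /eqP/deg_eq0 ->; exact: linear0.
apply: IHd => i ci0.
have [w wd] := I_top cI (deg_comb cP).
have [c' -> c'P] := ev_b_deg wd.
rewrite ev_comb => /(independent_inj ev_b_inj) cc'.
by apply: c'P; rewrite -cc'.
Qed.

Let subI u v : u \in I -> v \in I -> u - v \in I.
Proof. by move=> uI vI; rewrite -scaleN1r rpredD ?rpredZ. Qed.

Let coords v := projT1 (cid2 (b_span (leqnn (deg v)))).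

Let nf v := \sum_i coords v i *: b i.

Let nf_mod v : v - nf v \in I.
Proof. by rewrite /nf /coords; case: cid2. Qed.

Let nf_unique v c : v - \sum_i c i *: b i \in I -> coords v =1 c.
Proof.
move=> vI i; apply/eqP; rewrite -subr_eq0; apply/eqP.
apply: (b_independent_mod (c := fun i => coords v i - c i)).
under eq_bigr do rewrite scalerBl; rewrite sumrB -/(nf v).
rewrite -(subrK v (nf v)) -addrA addrC -[_ - v]opprB.
exact: subI.
Qed.

Let nf_lin : linear nf.
Proof.
move=> a u v; rewrite /nf scaler_sumr -big_split /=; apply: eq_bigr => i _.
rewrite scalerA -scalerDl; congr (_ *: _); move: i.
apply: (nf_unique (c := fun i => a * coords u i + coords v i)).
under eq_bigr do rewrite scalerDl -scalerA.
rewrite big_split /= -scaler_sumr opprD addrACA -scalerBr.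
by rewrite rpredD ?rpredZ ?nf_mod.
Qed.

Let nf_ideal v : v \in I -> nf v = 0.
Proof.
move=> vI; rewrite /nf big1 // => i _.
rewrite (nf_unique (c := fun=> 0)) ?scale0r //.
by rewrite big1 ?subr0 // => j _; rewrite scale0r.
Qed.

Let nf_deg v : (deg (nf v) <= deg v)%N.
Proof. by apply: deg_comb; rewrite /coords; case: cid2. Qed.

(** Averaging the projection [nf] over the group makes it equivariant, and
    keeps it a projection along [I] that does not raise degrees. *)
Let avg v := (size e)%:R^-1 *: \sum_(g <- e) gmod_act g (nf (gmod_act g^-1%g v)).

Let avg_lin : linear avg.
Proof.
move=> a u v; rewrite /avg [a *: (_ *: _)]scalerA mulrC -scalerA -scalerDr.
congr (_ *: _); rewrite scaler_sumr -big_split /=; apply: eq_bigr => g _.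
by rewrite linearP nf_lin linearP.
Qed.

Let size_e : (size e)%:R != 0 :> K.
Proof. by rewrite pnatr_eq0; case: e (e_full 1%g). Qed.

Let avg_mod v : v - avg v \in I.
Proof.
have -> : v - avg v = (size e)%:R^-1 *:
    \sum_(g <- e) gmod_act g (gmod_act g^-1%g v - nf (gmod_act g^-1%g v)).
  under eq_bigr => g _ do rewrite linearB /= -gmod_actM mulgV gmod_act1.
  rewrite sumrB scalerBr big_const_seq count_predT iter_addr_0 -scaler_nat.
  by rewrite scalerA mulVf // scale1r.
by rewrite rpredZ // rpred_sum // => g _; apply/I_stable/nf_mod.
Qed.

Let avg_ideal v : v \in I -> avg v = 0.
Proof.
move=> vI; rewrite /avg big1 ?scaler0 // => g _.
by rewrite nf_ideal ?linear0 //; apply: I_stable.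
Qed.

Let avg_deg v : (deg (avg v) <= deg v)%N.
Proof.
apply: leq_trans (degZ _ _) _; apply: deg_sum => g _.
exact: leq_trans (degJ _ _) (leq_trans (nf_deg _) (degJ _ _)).
Qed.

Let avgJ h v : avg (gmod_act h v) = gmod_act h (avg v).
Proof.
rewrite /avg [RHS]linearZ; congr (_ *: _); rewrite linear_sum.
have eh : perm_eq e [seq (h * g)%g | g <- e].
  apply: uniq_perm => //; first by rewrite map_inj_uniq //; apply: mulgI.
  move=> g; rewrite e_full; apply/esym/mapP; exists (h^-1 * g)%g => //.
  by rewrite mulKVg.
rewrite (perm_big _ eh) big_map; apply: eq_bigr => g _; rewrite [LHS]gmod_actM.
by rewrite -[gmod_act (h * g)^-1%g _]gmod_actM invMg mulgKV.
Qed.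

Let phi := ev \o avg.

Let phi_onto_deg d v : (deg v <= d)%N -> exists u, phi u = ev v.
Proof.
elim: d v => [|d IHd] v.
  rewrite leqn0 => /eqP/deg_eq0 ->; exists 0.
  by rewrite /phi /= avg_ideal ?rpred0.
move=> vd.
have [w /IHd[u uw] ew] := I_top (avg_mod v) (degB vd (leq_trans (avg_deg v) vd)).
exists (u + v); rewrite /phi /= -[u]scale1r avg_lin scale1r linearD /=.
by rewrite -[ev (avg u)]/(phi u) uw -ew linearB subrK.
Qed.

Let phi_comb c : phi (\sum_i c i *: b i) = \sum_i c i *: phi (b i).
Proof.
pose f : {linear V -> V} := HB.pack avg (GRing.isLinear.Build _ _ _ _ _ avg_lin).
rewrite /phi /= -[avg]/(f : V -> V) !linear_sum.
by apply: eq_bigr => i _; rewrite linearZ_LR linearZ_LR.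
Qed.

Let phi_mod u v : u - v \in I -> phi u = phi v.
Proof.
move=> /avg_ideal uv0; apply/eqP; rewrite -subr_eq0 -linearB /=.
by rewrite -[avg u - _]addrC -scaleN1r -avg_lin scaleN1r addrC uv0 linear0.
Qed.

Let phi_ker v : phi v = 0 -> v \in I.
Proof.
move=> v0.
have phi_b : independent (phi \o b).
  apply: W_dim => w; have [v' <-] := ev_onto w.
  have [u <-] := phi_onto_deg (leqnn (deg v')).
  exists (coords u); rewrite -phi_comb; exact/phi_mod/nf_mod.
have := phi_mod (nf_mod v); rewrite v0 phi_comb => /esym/phi_b c0.
have := nf_mod v; rewrite /nf big1 ?subr0 // => i _.
by rewrite c0 scale0r.
Qed.

(** [phi] kills [I], and it is onto because [ev v] and [phi v] differ by the
    image of an element of [I], that is of an element of smaller degree than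
    [v]. It kills nothing else: the images of the [b i] span [W], so they are
    independent by [W_dim]. *)
Theorem quot_iso_of_deformation : gmod_iso (quot_gmodule I_stable) W.
Proof.
pose f (x : quotmod I) := phi (repr x).
have fE v : f (\pi_(quotmod I) v) = phi v by apply/phi_mod/quotmod_repr.
have f_lin : linear f.
  move=> a x y; rewrite -[x]reprK -[y]reprK -quotmodZ -quotmodD !fE.
  by rewrite /phi /= avg_lin linearP.
pose F : {linear quotmod I -> W} :=
  HB.pack f (GRing.isLinear.Build K (quotmod I) W _ f f_lin).
exists F; split=> /=.
  have f_onto w : exists x, f x = w.
    have [v <-] := ev_onto w; have [u <-] := phi_onto_deg (leqnn (deg v)).
    by exists (\pi_(quotmod I) u); rewrite fE.
  have [h hK] := choice f_onto; exists h => // x.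
  have := hK (f x); rewrite -[h _]reprK -{2 4}[x]reprK !fE.
  move=> /eqP; rewrite -subr_eq0 => xy0; apply/eqP; rewrite quotmod_eq.
  apply: phi_ker; move: xy0; rewrite /phi /= -linearB /=.
  by rewrite addrC -scaleN1r -avg_lin scaleN1r addrC => /eqP.
move=> g x; rewrite -[in RHS](reprK x).
by rewrite [LHS]fE [in RHS]/= fE /phi /= avgJ evJ.
Qed.

End Comparison.

(** * A spanning set of monomials *)

Section StandardMonomials.
Variables (K : comNzRingType) (A : comAlgType K) (r a n : nat) (x : nat -> A).

(** In the layer of the power [j] of the last variable, the ideal given by the
    first [s] coefficients of [sym_gen] still contains [s] coefficients in the
    remaining variables if [j >= r * s], and only [s.-1] of them otherwise. For
    [m = 0] the product [sym_gen] is 1, so the quotient is zero unless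
    [s = 0]. *)
Fixpoint std_monomials (m s : nat) : seq A :=
  if m is m'.+1 then
    [seq x m' ^+ j * b | j <- iota 0 a,
                         b <- std_monomials m' (if (j < r * s)%N then s.-1 else s)]
  else if s == 0%N then [:: 1] else [::].

(** The coefficient of [T^i] is the elementary symmetric polynomial of degree
    [m - i] in the [x l ^+ r]; indexing by [i] makes the range of the
    coefficients that generate the ideal an initial segment [i < s]. *)
Definition sym_gen (m : nat) : {poly A} := \prod_(i < m) ('X + (x i ^+ r)%:P).

Lemma coef_sym_gen0 m : (sym_gen m.+1)`_0 = (sym_gen m)`_0 * x m ^+ r.
Proof. by rewrite /sym_gen big_ord_recr /= mulrDr coefD coefMX coefMC add0r. Qed.

Lemma coef_sym_genS m i :
  (sym_gen m.+1)`_i.+1 = (sym_gen m)`_i + (sym_gen m)`_i.+1 * x m ^+ r.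
Proof. by rewrite /sym_gen big_ord_recr /= mulrDr coefD coefMX coefMC. Qed.

Hypothesis r_gt0 : (0 < r)%N.
Hypothesis x_gen : forall p : A, exists (c : K) (q : 'I_n -> A),
  p = c%:A + \sum_(i < n) x i * q i.

Variable N : A -> Prop.
Hypothesis ND : forall u v, N u -> N v -> N (u + v).
Hypothesis NZ : forall c u, N u -> N (c *: u).

Let NB u v : N u -> N v -> N (u - v).
Proof. by move=> Nu Nv; rewrite -scaleN1r; apply/ND/NZ. Qed.

(** Write c_i and c'_i for the coefficients of the products over [m] and [m.+1]
    variables, and y for [x m ^+ r]. As c'_i = c_(i-1) + y c_i, one has
    y^(i+1) c_i = y^i c'_i - y^i c_(i-1), so by induction y^(i+1) c_i lies in the
    ideal of the c'_i. *)
Lemma sym_gen_shift m s t :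
    (forall i p, (i < s)%N -> N (t * (sym_gen m.+1)`_i * p)) ->
  forall i p, (i < s)%N -> N (t * x m ^+ (r * i.+1) * (sym_gen m)`_i * p).
Proof.
move=> tS; elim=> [|i IHi] p lt_is.
  have := tS 0%N p lt_is; rewrite coef_sym_gen0 muln1.
  by congr N; ring.
have := NB (tS _ (x m ^+ (r * i.+1) * p) lt_is) (IHi p (ltnW lt_is)).
rewrite coef_sym_genS [(r * i.+2)%N]mulnS exprD.
by congr N; ring.
Qed.

(** The factor [t] records the powers of the variables treated before, of index
    at least [m], and [N] contains all multiples of [t] by them; so [t] times the
    ring is determined modulo [N] by the first [m] variables, without having to
    restrict to the polynomials in these. *)
Lemma std_monomials_span m s t : (m <= n)%N ->
    (forall i p, (m <= i < n)%N -> N (t * x i * p)) ->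
    (forall i p, (i < m)%N -> N (t * x i ^+ a * p)) ->
    (forall i p, (i < s)%N -> N (t * (sym_gen m)`_i * p)) ->
    (forall b, b \in std_monomials m s -> N (t * b)) ->
  forall p, N (t * p).
Proof.
elim: m s t => [|m IHm] s t le_mn tx ta tS tb.
  case: s tS tb => [|s] tS tb p; last first.
    by have := tS 0%N p isT; rewrite /sym_gen big_ord0 coefC mulr1.
  have [c [q ->]] := x_gen p; rewrite mulrDr mulr_sumr.
  apply: ND; first by rewrite -scalerAr; apply/NZ/tb; rewrite inE.
  apply: (big_ind N) => //; first by rewrite -(scale0r (t * 1)); apply/NZ/tb; rewrite inE.
  by move=> i _; rewrite mulrA; apply: tx; rewrite ltn_ord.
(* Descending induction on the exponent j of the last variable, which becomes
   trivial at j = a; the bound d on a - j is what the induction is on. *)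
suff tX d j : (a <= j + d)%N -> forall p, N (t * x m ^+ j * p).
  by move=> p; have := tX a 0%N (leqnn a) p; rewrite expr0 mulr1.
elim: d j => [|d IHd] j; [|case: (leqP a j) => [le_aj _|lt_ja le_ajd]].
- rewrite addn0 => le_aj p; have := ta m (x m ^+ (j - a) * p) (leqnn _).
  by rewrite mulrA -[t * _ * _]mulrA -exprD subnKC.
- move=> p; have := ta m (x m ^+ (j - a) * p) (leqnn _).
  by rewrite mulrA -[t * _ * _]mulrA -exprD subnKC.
have tXS p : N (t * x m ^+ j.+1 * p) by apply: IHd; rewrite addSnnS.
apply: (IHm (if (j < r * s)%N then s.-1 else s)).
- exact: ltnW.
- move=> i p /andP[]; rewrite leq_eqVlt => /orP[/eqP <- _|lt_mi lt_in].
    by rewrite -[t * _ * _]mulrA -exprSr.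
  have := tx i (x m ^+ j * p); rewrite lt_mi lt_in => /(_ isT).
  by congr N; ring.
- move=> i p lt_im; have := ta i (x m ^+ j * p) (ltnW lt_im).
  by congr N; ring.
(* Below r * s, use c_i = c'_(i+1) - y c_(i+1), whose second term belongs to a
   higher layer. *)
- move=> i p; case: (ltnP j (r * s)) => [_ lt_is|le_sj lt_is].
    have lt_iSs : (i.+1 < s)%N by lia.
    have := NB (tS _ (x m ^+ j * p) lt_iSs) (tXS (x m ^+ r.-1 * (sym_gen m)`_i.+1 * p)).
    rewrite coef_sym_genS -[in x m ^+ r](prednK r_gt0) !exprS.
    by congr N; ring.
  have le_rj : (r * i.+1 <= j)%N by apply: leq_trans le_sj; rewrite leq_mul2l lt_is orbT.
  have := sym_gen_shift tS (x m ^+ (j - r * i.+1) * p) lt_is.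
  rewrite -[in x m ^+ j](subnKC le_rj) exprD.
  by congr N; ring.
- move=> b b_std; rewrite -mulrA; apply: tb; apply/allpairsPdep.
  by exists j, b; split=> //; rewrite mem_iota.
Qed.

End StandardMonomials.

(** * Words that meet prescribed classes of letters *)

Section Words.
Variables (r a : nat).

Fixpoint words (m : nat) : seq (seq nat) :=
  if m is m'.+1 then [seq j :: w | j <- iota 0 a, w <- words m'] else [:: [::]].

Lemma words_uniq m : uniq (words m).
Proof.
elim: m => //= m IHm; apply: allpairs_uniq; rewrite ?iota_uniq //.
by move=> [j w] [j' w'] _ _ [-> ->].
Qed.

Lemma mem_words m w : (w \in words m) = (size w == m) && all (gtn a) w.
Proof.
elim: m w => [|m IHm] [|j w] //=; first by apply/negbTE/allpairsP => -[[]] ? ? [].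
rewrite eqSS andbCA -IHm; apply/allpairsP/andP => [[[j' w'] /= [+ w'm [-> ->]]]|].
  by rewrite mem_iota.
by case=> lt_ja wm; exists (j, w); rewrite mem_iota.
Qed.

(** The letters [j < a] are grouped in classes of [r] consecutive ones; all the
    classes in [S] must occur in the word. *)
Definition hits (S : seq nat) (w : seq nat) := all (mem [seq j %/ r | j <- w]%N) S.

Lemma hits_cons S j w : uniq S -> hits S (j :: w) = hits (rem (j %/ r)%N S) w.
Proof.
move=> S_uniq; rewrite /hits rem_filter // all_filter; apply: eq_all => c /=.
by rewrite inE implyNb.
Qed.

Hypothesis r_gt0 : (0 < r)%N.

Lemma count_div S : uniq S -> (forall c, c \in S -> c.+1 * r <= a)%N ->
  count (fun j => j %/ r \in S)%N (iota 0 a) = (r * size S)%N.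
Proof.
elim: S => [|c S IHS] /=; first by rewrite muln0 count_pred0.
case/andP=> cS S_uniq Sa.
rewrite mulnS -IHS //; last by move=> d dS; apply: Sa; rewrite inE dS orbT.
pose f j := ((j %/ r)%N == c).
rewrite (@eq_count _ _ (predU f (fun j => (j %/ r)%N \in S))); last first.
  by move=> j; rewrite /= inE.
apply/eqP; rewrite -(eqn_add2r (count (predI f (fun j => (j %/ r)%N \in S)) (iota 0 a))).
rewrite count_predUI [count (predI _ _) _](_ : _ = 0%N) ?addn0; last first.
  apply/eqP; rewrite -leqn0 leqNgt -has_count; apply/hasPn => j _ /=.
  by rewrite /f; case: eqP => // ->.
rewrite eqn_add2r -size_filter.
rewrite (@perm_size _ _ (iota (c * r)%N r)) ?size_iota //.
apply: uniq_perm; rewrite ?filter_uniq ?iota_uniq // => j.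
have := Sa c; rewrite inE eqxx mulSn => /(_ isT) le_ca.
rewrite mem_filter !mem_iota /f eqn_leq -ltnS ltn_divLR // leq_divRL // mulSn.
by apply/idP/idP; lia.
Qed.

Lemma sumn_bool (F : bool -> nat) (P Q : pred nat) (s : seq nat) :
  count P s = count Q s -> sumn [seq F (P j) | j <- s] = sumn [seq F (Q j) | j <- s].
Proof.
have sumE P' : sumn [seq F (P' j) | j <- s] =
    (F true * count P' s + F false * (size s - count P' s))%N.
  elim: s => [|j s IHs] /=; first by rewrite !muln0.
  rewrite IHs; have := count_size P' s; case: (P' j) => le_s.
    by rewrite add1n subSS mulnS addnA.
  by rewrite add0n subSn // mulnS addnCA.
by rewrite !sumE => ->.
Qed.

(** There are [r * size S] letters in the classes of [S]. If the first letter is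
    one of them, the rest of the word has one class less to meet. This is the
    recursion of [std_monomials], where those letters come first. *)
Lemma count_hits (K : comNzRingType) (A : comAlgType K) (x : nat -> A) m S :
    uniq S -> (forall c, c \in S -> c.+1 * r <= a)%N ->
  count (hits S) (words m) = size (std_monomials r a x m (size S)).
Proof.
elim: m S => [|m IHm] S S_uniq Sa /=; first by case: S {S_uniq Sa}.
rewrite count_flatten -map_comp size_allpairs_dep.
have IHrem j : count (preim (cons j) (hits S)) (words m) =
    size (std_monomials r a x m (size S - (j %/ r \in S)%N)).
  rewrite (eq_count (fun w => hits_cons j w S_uniq)) IHm ?rem_uniq //.
    case: (boolP (_ \in S)) => jS; first by rewrite size_rem // subn1.
    by rewrite rem_id // subn0.
  by move=> c /mem_rem/Sa.
pose F (c : bool) := size (std_monomials r a x m (size S - c)).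
rewrite (_ : map _ _ = [seq F (j %/ r \in S)%N | j <- iota 0 a]); last first.
  by apply: eq_map => j; rewrite /= count_map IHrem.
rewrite [in RHS](_ : map _ _ = [seq F (j < r * size S)%N | j <- iota 0 a]); last first.
  by apply: eq_map => j; rewrite /F; case: (j < _)%N; rewrite ?subn1 ?subn0.
apply: sumn_bool; have count_S := count_div S_uniq Sa; rewrite count_S.
have le_Sa : (r * size S <= a)%N.
  by rewrite -count_S; apply: leq_trans (count_size _ _) _; rewrite size_iota.
have /perm_size : perm_eq [seq j <- iota 0 a | (j < r * size S)%N]
    (iota 0 (r * size S)).
  apply: uniq_perm; rewrite ?filter_uniq ?iota_uniq // => j.
  by rewrite mem_filter !mem_iota; apply/idP/idP; lia.
by rewrite size_filter size_iota => ->.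
Qed.

End Words.

(** * Degrees and homogeneous ideals of polynomials *)

Section Truncation.
Variables (K : fieldType) (n : nat).
Implicit Types (p q g : {mpoly K[n]}) (d e : nat).

Definition truncate d p : {mpoly K[n]} := \sum_(e < d) pihomog mdeg e p.

Lemma truncate_is_linear d : linear (truncate d).
Proof.
move=> a p q; rewrite /truncate scaler_sumr -big_split /=.
by apply: eq_bigr => e _; rewrite linearP.
Qed.

HB.instance Definition _ d := GRing.isLinear.Build K {mpoly K[n]} {mpoly K[n]} _
  (truncate d) (truncate_is_linear d).

Lemma truncate_id d p : (msize p <= d)%N -> truncate d p = p.
Proof. by move=> pd; rewrite [RHS](pihomog_partitionE pd). Qed.

Lemma truncate_homog d e p : p \is e.-homog ->
  truncate d p = if (e < d)%N then p else 0.
Proof.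
move=> p_hom; rewrite /truncate; case: ltnP => [lt_ed|le_de].
  rewrite (bigD1 (Ordinal lt_ed)) //= (pihomog_dE p_hom) big1 ?addr0 // => i ne.
  by apply: (pihomog_ne0 _ p_hom); rewrite eq_sym.
rewrite big1 // => i _; apply: (pihomog_ne0 _ p_hom).
by rewrite gtn_eqF // (leq_trans (ltn_ord i)).
Qed.

Lemma msize_homog d p : p \is d.-homog -> (msize p <= d.+1)%N.
Proof.
move=> /dhomogP p_hom; rewrite msizeE; apply/bigmax_leqP_seq => m mp _.
by rewrite p_hom.
Qed.

Lemma msize_sum_le (T : Type) (s : seq T) (P : pred T) (F : T -> {mpoly K[n]}) d :
  (forall i, P i -> (msize (F i) <= d)%N) -> (msize (\sum_(i <- s | P i) F i) <= d)%N.
Proof.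
move=> FP; apply: (big_ind (fun p => (msize p <= d)%N)) => //.
  by rewrite mmeasure0.
by move=> u v ud vd; apply: leq_trans (mmeasureD_le _ _ _) _; rewrite geq_max ud vd.
Qed.

Lemma msize_truncate d p : (msize (truncate d p) <= d)%N.
Proof.
apply: msize_sum_le => e _.
exact: leq_trans (msize_homog (pihomogP _ _ _)) (ltn_ord e).
Qed.

Lemma truncateM d e p g : g \is e.-homog ->
  truncate d (p * g) = truncate (d - e) p * g.
Proof.
move=> g_hom; rewrite [p in LHS](pihomog_partitionE (leqnn (msize p))).
rewrite [p in RHS](pihomog_partitionE (leqnn (msize p))).
rewrite mulr_suml !linear_sum mulr_suml; apply: eq_bigr => j _ /=.
have p_hom := pihomogP mdeg j p.
rewrite (truncate_homog _ (dhomogM p_hom g_hom)) (truncate_homog _ p_hom).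
by rewrite ltn_subRL addnC; case: ifP; rewrite ?mul0r.
Qed.

Lemma dhomog_bigprod (T : Type) (s : seq T) (P : pred T) (e : T -> nat)
    (F : T -> {mpoly K[n]}) : (forall i, P i -> F i \is (e i).-homog) ->
  \prod_(i <- s | P i) F i \is (\sum_(i <- s | P i) e i)%N.-homog.
Proof.
move=> FP; elim/big_rec2: _ => [|i p d Pi p_hom]; first exact: dhomog1.
by apply: dhomogM => //; apply: FP.
Qed.

Section HomogeneousIdeal.
Variables (gens : seq {mpoly K[n]}) (dg : 'I_(size gens) -> nat).
Hypothesis gens_homog : forall i : 'I_(size gens), gens`_i \is (dg i).-homog.

(** Truncating a combination of homogeneous generators amounts to truncating its
    coefficients, so that no cancellation in high degrees remains. *)
Lemma ideal_truncate_comb d v : v \in ideal gens ->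
  exists2 c : 'I_(size gens) -> {mpoly K[n]},
    truncate d v = \sum_i c i * gens`_i &
    forall i, (msize (c i) <= d - dg i)%N.
Proof.
move=> /idealP[c ->]; exists (fun i => truncate (d - dg i) (c i)) => [|i].
  by rewrite linear_sum; apply: eq_bigr => i _ /=; rewrite (truncateM _ _ (gens_homog i)).
exact: msize_truncate.
Qed.

Lemma ideal_truncate d v : v \in ideal gens -> truncate d v \in ideal gens.
Proof.
move=> /(ideal_truncate_comb d)[c -> _]; apply: rpred_sum => i _.
exact/ideal_mul/ideal_gen/mem_nth.
Qed.

(** When the generators are the top degree parts of the [h i], an element of the
    ideal can be lowered in degree by a combination of the [h i]. *)
Lemma ideal_lower_degree (h : 'I_(size gens) -> {mpoly K[n]}) d v :
    (forall i : 'I_(size gens), msize (gens`_i - h i) <= dg i)%N ->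
    v \in ideal gens -> (msize v <= d.+1)%N ->
  exists (v' : {mpoly K[n]}) (c : 'I_(size gens) -> {mpoly K[n]}),
    (msize v' <= d)%N /\ v = v' + \sum_i c i * h i.
Proof.
move=> h_top /(ideal_truncate_comb d.+1)[c + c_deg] vd; rewrite truncate_id // => ->.
exists (\sum_i c i * (gens`_i - h i)), c; split; last first.
  by rewrite -big_split; apply: eq_bigr => i _ /=; rewrite mulrBr subrK.
apply: msize_sum_le => i _; have := c_deg i.
have [->|c0] := eqVneq (c i) 0; first by rewrite mul0r mmeasure0.
have [->|g0] := eqVneq (gens`_i - h i) 0; first by rewrite mulr0 mmeasure0.
have : (msize (c i) != 0)%N by rewrite mmeasure_poly_eq0.
rewrite msizeM //; have := h_top i.
by move: (msize _) (msize _) (dg i) => x y z; lia.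
Qed.

(** Homogeneous elements that span modulo a homogeneous ideal do so degree by
    degree: truncate the relation. *)
Lemma span_degree (N : nat) (b : 'I_N -> {mpoly K[n]}) (db : 'I_N -> nat) :
    (forall i, b i \is (db i).-homog) ->
    (forall v, exists c : 'I_N -> K, v - \sum_i c i *: b i \in ideal gens) ->
  forall d v, (msize v <= d)%N -> exists2 c : 'I_N -> K,
    v - \sum_i c i *: b i \in ideal gens &
    forall i, c i != 0 -> (msize (b i) <= d)%N.
Proof.
move=> b_hom b_span d v vd; have [c /(ideal_truncate d)] := b_span v.
rewrite linearB /= truncate_id // (linear_sum (truncate d)) => cI.
exists (fun i => if (db i < d)%N then c i else 0) => [|i].
  rewrite [X in _ - X](_ : _ = \sum_i truncate d (c i *: b i)) //.
  apply: eq_bigr => i _; rewrite linearZ /= (truncate_homog _ (b_hom i)).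
  by case: ifP; rewrite ?scaler0 ?scale0r.
case: ifP => [lt_d _|]; last by rewrite eqxx.
exact: leq_trans (msize_homog (b_hom i)) lt_d.
Qed.

End HomogeneousIdeal.
End Truncation.

(** * Elementary symmetric polynomials *)

Section ElementarySymmetric.
Variable n : nat.

Definition elem_sym (B : comNzRingType) (y : 'I_n -> B) (d : nat) : B :=
  \sum_(h : {set 'I_n} | #|h| == d) \prod_(i in h) y i.

Lemma coef_prod_XaddC (B : comNzRingType) (y : 'I_n -> B) j : (j <= n)%N ->
  (\prod_i ('X + (y i)%:P))`_j = elem_sym y (n - j).
Proof.
move=> le_jn; under eq_bigr do rewrite addrC.
rewrite bigA_distr coef_sum /elem_sym [RHS]big_mkcond /=; apply: eq_bigr => h _.
rewrite (bigID (mem h)) /= (eq_bigr (fun i => (y i)%:P)) => [|i -> //].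
rewrite [X in _ * X](eq_bigr (fun=> 'X)) => [|i /negPf -> //].
rewrite -rmorph_prod prodr_const coefCM coefXn.
have -> : #|[pred i | i \notin h]| = (n - #|h|)%N.
  have := cardC (mem h); rewrite card_ord => hE.
  by rewrite -[X in (X - _)%N]hE addKn; apply: eq_card => i; rewrite !inE.
have le_hn : (#|h| <= n)%N by rewrite -[X in (_ <= X)%N]card_ord max_card.
rewrite (_ : (j == n - #|h|)%N = (#|h| == n - j)%N); last first.
  by move: #|h| le_hn => c le_cn; apply/eqP/eqP; lia.
by case: eqP; rewrite ?mulr1 ?mulr0.
Qed.

Lemma size_prod_XaddC (B : idomainType) (y : 'I_n -> B) :
  size (\prod_i ('X + (y i)%:P)) = n.+1.
Proof.
under eq_bigr do rewrite -[(y _)%:P]opprK -polyCN.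
by rewrite -big_enum /= size_prod_XsubC size_enum_ord.
Qed.

End ElementarySymmetric.

(** * Lowering the generators by polynomials that vanish on the locus *)

Section Generators.
Variables (R : realType) (r n : nat).
Local Notation C := R[i].
Local Notation elem_sym_pow := (elem_sym_pow R r n).

Lemma elem_sym_powE d :
  elem_sym_pow d = elem_sym (fun i => 'X_i ^+ r : {mpoly C[n]}) d.
Proof.
rewrite /Defs.elem_sym_pow mesymE /elem_sym rmorph_sum; apply: eq_bigr => h _ /=.
rewrite comp_mpolyX [RHS]big_mkcond; apply: eq_bigr => i _ /=.
by rewrite tnth_mktuple mnmE; case: (i \in h); rewrite ?expr1 ?expr0.
Qed.

Lemma elem_sym_pow_homog d : elem_sym_pow d \is (r * d).-homog.
Proof.
rewrite elem_sym_powE /elem_sym; apply: rpred_sum => h /eqP <-.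
rewrite mulnC -sum_nat_const; apply: dhomog_bigprod => i _.
by rewrite mpolyXn dhomogX /= mdegMn mdeg1 mul1n.
Qed.

Lemma meval_elem_sym_pow v d :
  (elem_sym_pow d).@[v] = elem_sym (fun i => v i ^+ r) d.
Proof.
rewrite elem_sym_powE /elem_sym raddf_sum /=; apply: eq_bigr => h _.
rewrite rmorph_prod; apply: eq_bigr => i _.
by rewrite rmorphXn /= mevalXU.
Qed.

Variables (bs : seq C) (k : nat) (z : bool).
Hypothesis r_gt0 : (0 < r)%N.
Hypothesis bs_uniq : uniq bs.
Hypothesis size_bs : size bs = k.
Hypothesis le_kn : (k <= n)%N.

(** What the vanishing of the lowered generators requires of a point: the first
    condition serves the powers of the variables, the second one the elementary
    symmetric polynomials. *)
Definition in_locus (v : 'I_n -> C) : Prop :=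
  (forall i, (v i ^+ r \in bs) || z && (v i == 0)) /\
  (forall c, c \in bs -> exists i, v i ^+ r = c).

Let B : {poly C} := \prod_(c <- bs) ('X - (- c)%:P).

Let size_B : size B = k.+1.
Proof. by rewrite size_prod_XsubC size_bs. Qed.

(** The coefficient of [T^j] in the remainder modulo [B] of the product of the
    [T + x_i ^+ r]. *)
Definition lower_elem_sym (j : nat) : {mpoly C[n]} :=
  \sum_(i < n.+1) ('X^i %% B)`_j *: elem_sym_pow (n - i).

(** At a point of the locus, the roots of [B] are among those of the product, so
    that [B] divides it. *)
Lemma lower_elem_sym_vanish v j : in_locus v -> (lower_elem_sym j).@[v] = 0.
Proof.
move=> [_ v_onto]; pose P : {poly C} := \prod_i ('X + (v i ^+ r)%:P).
have /modp_eq0P PB : B %| P.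
  rewrite /B -(big_map -%R xpredT (fun c => 'X - c%:P)).
  apply: uniq_roots_dvdp; last first.
    by rewrite uniq_rootsE map_inj_uniq //; apply: oppr_inj.
  apply/allP => _ /mapP[c /v_onto[i <-] ->].
  by rewrite rootE /P horner_prod (bigD1 i) //= !hornerE addNr mul0r.
rewrite -[RHS](coef0 _ j) -PB.
have PE : P = \sum_(i < n.+1) P`_i *: 'X^i.
  by rewrite -poly_def -(size_prod_XaddC (fun i => v i ^+ r)) coefK.
have modP : P %% B = \sum_(i < n.+1) P`_i *: ('X^i %% B).
  rewrite {1}PE; elim/big_ind2: _ => [|p p' q q' <- <-|i _]; first exact: mod0p.
    exact: modpD.
  exact: modpZl.
rewrite modP coef_sum /lower_elem_sym raddf_sum /=; apply: eq_bigr => i _.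
rewrite mevalZ meval_elem_sym_pow coefZ mulrC; congr (_ * _).
by rewrite coef_prod_XaddC // -ltnS.
Qed.

(** The powers of [T] below the degree [k] of [B] are their own remainders, so
    that the other terms come from higher powers of [T], that is from elementary
    symmetric polynomials of lower degree. *)
Lemma lower_elem_sym_top j : (j < k)%N ->
  (msize (elem_sym_pow (n - j) - lower_elem_sym j) <= r * (n - j))%N.
Proof.
move=> lt_jk; have lt_jn : (j < n.+1)%N by rewrite ltnS ltnW // (leq_trans lt_jk).
rewrite /lower_elem_sym (bigD1 (Ordinal lt_jn)) //=.
have small i : (i < k)%N -> ('X^i %% B : {poly C}) = 'X^i.
  by move=> lt_ik; rewrite modp_small // size_polyXn size_B ltnS.
rewrite small // coefXn eqxx scale1r opprD addNKr mmeasureN.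
apply: msize_sum_le => i ne_ij; have [lt_ik|le_ki] := ltnP i k.
  rewrite small // coefXn; move: ne_ij; rewrite -val_eqE /= eq_sym => /negPf->.
  by rewrite scale0r mmeasure0.
apply: leq_trans (msizeZ_le _ _) (leq_trans (msize_homog (elem_sym_pow_homog _)) _).
by rewrite ltn_mul2l r_gt0 ltn_sub2l // (leq_trans lt_jk).
Qed.

Lemma msizeM_pred (p q : {mpoly C[n]}) : (msize (p * q) <= (msize p + msize q).-1)%N.
Proof.
have [->|p0] := eqVneq p 0; first by rewrite mul0r mmeasure0.
have [->|q0] := eqVneq q 0; first by rewrite mulr0 mmeasure0.
by rewrite msizeM.
Qed.

Definition lower_power (i : 'I_n) : {mpoly C[n]} :=
  'X_i ^+ z * \prod_(c <- bs) ('X_i ^+ r - c%:MP).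

Lemma msize_expX (i : 'I_n) m : msize ('X_i ^+ m : {mpoly C[n]}) = m.+1.
Proof. by rewrite mpolyXn msizeX mdegMn mdeg1 mul1n. Qed.

Lemma lower_power_top i :
  (msize ('X_i ^+ (k * r + z) - lower_power i) <= k * r + z)%N.
Proof.
rewrite addnC exprD /lower_power -mulrBr.
apply: leq_trans (msizeM_pred _ _) _; rewrite msize_expX addSn /= leq_add2l.
rewrite -size_bs; elim: bs => [|c s IHs] /=.
  by rewrite big_nil mul0n expr0 subrr mmeasure0.
rewrite big_cons mulSn exprD.
set p := \prod_(c <- s) _ in IHs *.
rewrite (_ : _ - _ = 'X_i ^+ r * ('X_i ^+ (size s * r) - p) + c *: p); last first.
  by rewrite -mul_mpolyC; ring.
have size_prod : (msize p <= (size s * r).+1)%N.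
  rewrite -[X in msize X](subKr ('X_i ^+ (size s * r))).
  apply: leq_trans (mmeasureD_le _ _ _) _; rewrite mmeasureN geq_max.
  by rewrite msize_expX leqnn ltnW.
apply: leq_trans (mmeasureD_le _ _ _) _; rewrite geq_max; apply/andP; split.
  by apply: leq_trans (msizeM_pred _ _) _; rewrite msize_expX addSn leq_add2l.
apply: leq_trans (msizeZ_le _ _) (leq_trans size_prod _).
by rewrite -add1n leq_add2r.
Qed.

Lemma lower_power_vanish v i : in_locus v -> (lower_power i).@[v] = 0.
Proof.
move=> [/(_ i) v_in _]; rewrite /lower_power mevalM rmorphXn /= mevalXU.
case/orP: v_in => [v_bs|/andP[-> /eqP->]]; last by rewrite expr1 mul0r.
rewrite rmorph_prod (big_rem _ v_bs) /= mevalB rmorphXn /= mevalXU mevalC.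
by rewrite subrr mul0r mulr0.
Qed.

End Generators.

Section IndexedGenerators.
Variables (R : realType) (r n k : nat).
Local Notation C := R[i].
Local Notation elem_sym_pow := (elem_sym_pow R r n).

Lemma size_power_gens m : size (power_gens R r n m k) = (n + k)%N.
Proof. by rewrite size_cat 2!size_map size_enum_ord size_iota. Qed.

(** A function of the index of a generator in [power_gens]: [f] on the powers of
    the variables, then [g] on the elementary symmetric polynomials. *)
Definition on_gens (T : Type) (f : 'I_n -> T) (g : nat -> T) (i : nat) : T :=
  if insub i is Some l then f l else g (i - n)%N.

Lemma on_gensP (T : Type) (f : 'I_n -> T) (g : nat -> T) (P : nat -> T -> Prop) i :
  (forall l : 'I_n, P l (f l)) -> (forall j, (j < k)%N -> P (n + j)%N (g j)) ->
  (i < n + k)%N -> P i (on_gens f g i).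
Proof.
move=> Pf Pg lt_i; rewrite /on_gens; have [lt_in|le_ni] := ltnP i n.
  by rewrite insubT; exact: (Pf (Ordinal lt_in)).
rewrite insubF ?ltnNge ?le_ni // -[X in P X](subnKC le_ni); apply: Pg; lia.
Qed.

Lemma power_gensE m i : (i < n + k)%N -> (power_gens R r n m k)`_i =
  on_gens (fun l => 'X_l ^+ m) (fun j => elem_sym_pow (n - j)) i.
Proof.
apply: (on_gensP (P := fun i p => (power_gens R r n m k)`_i = p)) => [l|j lt_jk].
  rewrite nth_cat size_map size_enum_ord ltn_ord.
  by rewrite (nth_map l) ?size_enum_ord // nth_ord_enum.
rewrite nth_cat size_map size_enum_ord ltnNge leq_addr addKn.
rewrite (nth_map 0%N); last by rewrite size_iota.
by have -> : nth 0%N (iota 0 k) j = j by rewrite nth_iota.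
Qed.

End IndexedGenerators.

(** * The quotient as functions on a point locus *)

Section GroupEnum.
Variables (R : realType) (r n : nat).
Hypothesis r_gt0 : (0 < r)%N.

Lemma Gn_finite : exists e : seq (Gn R r n), uniq e /\ forall A, A \in e.
Proof.
have zP := zeta_prim R r_gt0.
have zu (c : {ffun 'I_n -> 'I_r}) l : (zeta R r ^+ c l) ^+ r = 1.
  by rewrite exprAC (prim_expr_order zP) expr1n.
have z0 (c : {ffun 'I_n -> 'I_r}) l : zeta R r ^+ c l != 0.
  apply/eqP => c0; have := zu c l; rewrite c0 expr0n gtn_eqF // => /eqP.
  by rewrite eq_sym oner_eq0.
pose f (p : 'S_n * {ffun 'I_n -> 'I_r}) := MkGn (mono_mxP p.1 (z0 p.2) (zu p.2)).
exists (undup [seq f p | p <- enum {: 'S_n * {ffun 'I_n -> 'I_r}}]).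
split=> [|A]; first exact: undup_uniq.
rewrite mem_undup; apply/mapP.
have rootA l := prim_rootP zP (Gn_valX A l).
exists (Gn_perm A, [ffun l => sval (rootA l)]); first by rewrite mem_enum.
apply: val_inj; rewrite /= [LHS]Gn_mxE; apply/matrixP => i l; rewrite !mxE ffunE.
by case: (rootA l) => c /= ->.
Qed.

End GroupEnum.

Section Evaluation.
Variables (K : fieldType) (n : nat).

Lemma lagrange (Y : finType) (pt : Y -> 'I_n -> K) : injective pt ->
  forall y, exists p : {mpoly K[n]}, forall x, p.@[pt x] = (x == y)%:R.
Proof.
move=> pt_inj y.
have sep x : exists p : {mpoly K[n]}, p.@[pt y] = 1 /\ (x != y -> p.@[pt x] = 0).
  have [->|ne_xy] := eqVneq x y; first by exists 1; rewrite meval1.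
  have /existsP[i ne_i] : [exists i, pt y i != pt x i].
    apply: contraNT ne_xy => /existsPn same; apply/eqP/pt_inj/funext => i.
    by apply/eqP; rewrite eq_sym -[_ == _]negbK same.
  exists ((pt y i - pt x i)^-1 *: ('X_i - (pt x i)%:MP)).
  by rewrite !mevalZ !mevalB !mevalXU !mevalC subrr mulr0 mulVf // subr_eq0.
have [q qP] := choice sep.
exists (\prod_x q x) => x; rewrite rmorph_prod /=.
have [->|ne_xy] := eqVneq x y; first by rewrite big1 // => x' _; case: (qP x').
by rewrite (bigD1 x) //= (proj2 (qP x) ne_xy) mul0r.
Qed.

(** The variables indexed by [nat], as needed for a recursion on their number. *)
Definition var (i : nat) : {mpoly K[n]} :=
  if insub i is Some l then 'X_(l : 'I_n) else 0.

Lemma var_ord (i : 'I_n) : var i = 'X_i.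
Proof. by rewrite /var valK. Qed.

Lemma split_const (p : {mpoly K[n]}) : exists (c : K) (q : 'I_n -> {mpoly K[n]}),
  p = c%:A + \sum_(i < n) var i * q i.
Proof.
elim/mpolyind: p => [|c m p _ _ [d [q ->]]].
  exists 0, (fun=> 0); rewrite scale0r add0r big1 // => i _; exact: mulr0.
have [->|m0] := eqVneq m 0%MM.
  by exists (c + d), q; rewrite mpolyX0 scalerDl addrA.
have /existsP[i mi0] : [exists i, m i != 0%N].
  apply: contraNT m0 => /existsPn m0; apply/eqP/mnmP => i.
  by rewrite mnm0E; apply/eqP; rewrite -[_ == _]negbK m0.
exists d, (fun j => q j + if j == i then c *: 'X_[m - U_(i)] else 0).
under [in RHS]eq_bigr do rewrite mulrDr.
rewrite big_split /= addrCA; congr (_ + _).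
rewrite addrC; congr (_ + _); rewrite (bigD1 i) //= eqxx big1 => [|j /negPf ->].
  rewrite addr0 var_ord -scalerAr -mpolyXD addmC submK //.
  by apply/mnm_lepP => j; rewrite mnm1E; case: eqP => // <-; rewrite lt0n.
by rewrite mulr0.
Qed.

Lemma std_monomials_homog r a m s b : (m <= n)%N ->
  b \in std_monomials r a var m s -> exists d, b \is d.-homog.
Proof.
elim: m s b => [|m IHm] s b le_mn /=.
  by case: eqP => // _; rewrite inE => /eqP ->; exists 0%N; apply: dhomog1.
case/allpairsPdep=> j [b' [_ /(IHm _ _ (ltnW le_mn))[d b'_hom] ->]].
exists (1 * j + d)%N; apply: dhomogM => //; apply: dhomogMn.
by rewrite (var_ord (Ordinal le_mn)) dhomogX /= mdeg1.
Qed.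

End Evaluation.

Lemma msize_poly_act (R : realType) (r n : nat) (A : Gn R r n) p :
  (msize (poly_act A p) <= msize p)%N.
Proof.
rewrite poly_actE big_seq; apply: msize_sum_le => m mp.
apply: leq_trans (msizeZ_le _ _) _; apply: leq_trans (msize_mdeg_lt mp).
apply: msize_homog; rewrite /poly_act comp_mpolyX mdegE.
apply: dhomog_bigprod => i _; rewrite tnth_mktuple -[m i in X in X.-homog]mul1n.
by apply/dhomogMn/dhomogZ; rewrite dhomogX /= mdeg1.
Qed.

Section PointLocus.
Variables (R : realType) (r n k : nat) (z : bool) (bs : seq R[i]).
Local Notation C := R[i].
Variables (Y : gset (Gn R r n)) (pt : Y -> 'I_n -> C).
Hypothesis r_gt0 : (0 < r)%N.
Hypothesis bs_uniq : uniq bs.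
Hypothesis size_bs : size bs = k.
Hypothesis le_kn : (k <= n)%N.
Hypothesis pt_inj : injective pt.
Hypothesis pt_locus : forall y, in_locus r bs z (pt y).
Hypothesis pt_act : forall (A : Gn R r n) y l,
  pt (gset_act A y) (Gn_perm A l) = Gn_val A l * pt y l.

Let a := (k * r + z)%N.
Let gens := power_gens R r n a k.
Let std := std_monomials r a (@var C n) n k.
Hypothesis Y_large : (size std <= #|Y|)%N.

Definition evaluate (p : {mpoly C[n]}) : {ffun Y -> C^o} := [ffun y => p.@[pt y]].

Lemma evaluate_lin : linear evaluate.
Proof. by move=> c p q; apply/ffunP => y; rewrite !ffunE mevalD mevalZ. Qed.

HB.instance Definition _ := GRing.isLinear.Build C {mpoly C[n]} {ffun Y -> C^o} _
  evaluate evaluate_lin.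

Lemma evaluateJ (A : Gn R r n) p :
  evaluate (poly_act A p) = perm_act A (evaluate p).
Proof.
apply/ffunP => y; rewrite !ffunE (big_pred1 (gset_act A^-1%g y)); last first.
  move=> x /=; apply/eqP/eqP => [<-|->]; rewrite -gset_actM.
    by rewrite mulVg gset_act1.
  by rewrite mulgV gset_act1.
rewrite ffunE /poly_act comp_mpoly_meval; congr meval; apply/funext => l.
rewrite tnth_mktuple mevalZ mevalXU -{1}[y](gset_act1) -(mulgV A) gset_actM pt_act.
by rewrite mulKf ?Gn_val_neq0.
Qed.

Lemma evaluate_onto f : exists p, evaluate p = f.
Proof.
have [L LP] := choice (lagrange pt_inj).
exists (\sum_y f y *: L y); apply/ffunP => x; rewrite ffunE raddf_sum /=.
rewrite (bigD1 x) //= big1 => [|y ne]; rewrite mevalZ LP.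
  by rewrite addr0 eqxx mulr1.
by rewrite eq_sym (negPf ne) mulr0.
Qed.

Let dg := on_gens (fun _ : 'I_n => a) (fun j => r * (n - j))%N.
Let lower := on_gens (lower_power r bs z) (lower_elem_sym r n bs).

Let gens_ind (P : {mpoly C[n]} -> nat -> {mpoly C[n]} -> Prop) :
  (forall l : 'I_n, P ('X_l ^+ a) a (lower_power r bs z l)) ->
  (forall j, (j < k)%N ->
     P (elem_sym_pow R r n (n - j)) (r * (n - j))%N (lower_elem_sym r n bs j)) ->
  forall i : 'I_(size gens), P gens`_i (dg i) (lower i).
Proof.
move=> PX Pe i; have lt_i : (i < n + k)%N by rewrite -(size_power_gens R r n k a).
rewrite power_gensE //.
apply: (on_gensP (P := fun i p => P p (dg i) (lower i))) lt_i => [l|j lt_jk].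
  by rewrite /dg /lower /on_gens valK.
rewrite /dg /lower /on_gens insubF; last by rewrite ltnNge leq_addr.
by rewrite addKn; apply: Pe.
Qed.

Let gens_homog (i : 'I_(size gens)) : gens`_i \is (dg i).-homog.
Proof.
move: i; apply: (gens_ind (P := fun p d _ => p \is d.-homog)) => [l|j _].
  by rewrite -[a in X in X.-homog]mul1n; apply: dhomogMn; rewrite dhomogX /= mdeg1.
exact: elem_sym_pow_homog.
Qed.

Let lower_top (i : 'I_(size gens)) : (msize (gens`_i - lower i) <= dg i)%N.
Proof.
move: i; apply: (gens_ind (P := fun p d q => msize (p - q) <= d)%N) => [l|j lt_jk].
  exact: (lower_power_top z r_gt0 size_bs l).
exact: (lower_elem_sym_top r_gt0 size_bs le_kn lt_jk).
Qed.

Let lower_vanish (i : 'I_(size gens)) y : (lower i).@[pt y] = 0.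
Proof.
move: i; apply: (gens_ind (P := fun _ _ q => q.@[pt y] = 0)) => [l|j lt_jk].
  exact: lower_power_vanish.
exact: lower_elem_sym_vanish.
Qed.

Let std_span p : exists c : 'I_(size std) -> C,
  p - \sum_i c i *: std`_i \in ideal gens.
Proof.
pose N (p : {mpoly C[n]}) := exists c : 'I_(size std) -> C,
  p - \sum_i c i *: std`_i \in ideal gens.
have NI q : q \in ideal gens -> N q.
  by exists (fun=> 0); rewrite big1 ?subr0 // => i _; rewrite scale0r.
pose gen := on_gens (fun l => 'X_l ^+ a) (fun j => elem_sym_pow R r n (n - j)).
have genI i q : (i < n + k)%N -> N (1 * gen i * q).
  move=> lt_i; apply: NI; rewrite /gen mul1r mulrC -(@power_gensE R r n k a i lt_i).
  by apply/ideal_mul/ideal_gen/mem_nth; rewrite size_power_gens.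
suff : N (1 * p) by rewrite mul1r.
apply: (@std_monomials_span C {mpoly C[n]} r a n (@var C n) _ _ N _ _ n k) => //.
- exact: split_const.
- move=> u v [c cu] [d dv]; exists (fun i => c i + d i).
  under eq_bigr do rewrite scalerDl.
  by rewrite big_split opprD addrACA rpredD.
- move=> e u [c cu]; exists (fun i => e * c i).
  under eq_bigr do rewrite -scalerA.
  by rewrite -scaler_sumr -scalerBr rpredZ.
- by move=> i q; case: ltnP.
- move=> i q lt_in; have := genI i q (leq_trans lt_in (leq_addr k n)).
  by rewrite /gen /on_gens /var insubT.
- move=> j q lt_jk; have := genI (n + j)%N q.
  rewrite ltn_add2l => /(_ lt_jk); rewrite /gen /on_gens insubF; last first.
    by rewrite ltnNge leq_addr.
  rewrite addKn /sym_gen.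
  under eq_bigr do rewrite var_ord.
  by rewrite coef_prod_XaddC ?elem_sym_powE // ltnW // (leq_trans lt_jk).
- move=> b b_std; exists (fun i => (i == index b std :> nat)%:R).
  have lt_b : (index b std < size std)%N by rewrite index_mem.
  rewrite mul1r (bigD1 (Ordinal lt_b)) //= eqxx scale1r nth_index // big1.
    by rewrite addr0 subrr rpred0.
  by move=> i; rewrite -val_eqE /= => /negPf ->; rewrite scale0r.
Qed.

(** [pt_act] says that [pt] is equivariant for the action of monomial matrices
    on column vectors; the action on polynomials is the induced one. *)
Theorem locus_iso : gmod_iso
  (@quot_gmodule C (Gn R r n) (poly_gmodule R r n) (ideal gens)
    (@power_ideal_stable R r n a k))
  (perm_module C Y).
Proof.
have [e [e_uniq e_full]] := Gn_finite R n r_gt0.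
have [db std_homog] : exists db, forall i : 'I_(size std), std`_i \is (db i).-homog.
  have std_h (i : 'I_(size std)) : exists d, std`_i \is d.-homog.
    apply: std_monomials_homog (leqnn n) _; exact: mem_nth.
  by have [db dbP] := choice std_h; exists db.
apply: (@quot_iso_of_deformation C (Gn R r n) (poly_gmodule R r n) (perm_module C Y)
  (ideal gens) evaluate (fun p : {mpoly C[n]} => msize p)
  (size std) (fun i => std`_i) e) => //=.
- exact: evaluateJ.
- exact: evaluate_onto.
- exact: mmeasure0.
- by move=> v /eqP; rewrite mmeasure_poly_eq0 => /eqP.
- exact: mmeasureD_le.
- by move=> c v; apply: msizeZ_le.
- exact: msize_poly_act.
- move=> d v vI vd.
  have [v' [c [v'd ->]]] := ideal_lower_degree gens_homog lower_top vI vd.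
  exists v' => //; apply/ffunP => y; rewrite !ffunE mevalD raddf_sum /=.
  rewrite big1 ?addr0 // => i _.
  by rewrite mevalM lower_vanish mulr0.
- move=> d v vd; have [c vI cP] := span_degree gens_homog std_homog std_span vd.
  by exists c.
- by move=> u; apply: spans_independent.
Qed.

End PointLocus.

(** * The points of the faces *)

Section FacePoints.
Variables (R : realType) (r n : nat).
Local Notation C := R[i].
Local Notation Gn := (Gn R r n).
Local Notation colored_blocks := (colored_blocks r n).
Implicit Types (s t : colored_blocks) (A : Gn) (i : 'I_n).
Hypothesis r_gt0 : (0 < r)%N.

Definition letter_pos s i := find (fun X : {set 'I_n} => i \in X) (blocks s).

(** The zero block, if any, comes first, so subtracting it from [letter_pos]
    numbers the nonzero blocks from 0. *)
Definition face_point s i : C :=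
  if color s i is Some c then
    (letter_pos s i - has_zero_block s).+1%:R * zeta R r ^+ c else 0.

Lemma zeta_neq0 : zeta R r != 0.
Proof.
apply/eqP => z0; have := prim_expr_order (zeta_prim R r_gt0).
by rewrite z0 expr0n gtn_eqF // => /eqP; rewrite eq_sym oner_eq0.
Qed.

Lemma letter_pos_act A s i : letter_pos (blocks_act A s) (Gn_perm A i) = letter_pos s i.
Proof.
rewrite /letter_pos /blocks /= find_map; apply: eq_find => X /=.
by rewrite mem_imset //; apply: perm_inj.
Qed.

Lemma face_point_act A s i :
  face_point (blocks_act A s) (Gn_perm A i) = Gn_val A i * face_point s i.
Proof.
rewrite /face_point letter_pos_act has_zero_block_act {1}/color /= ffunE permK.
case: (color s i) => [c|] /=; last by rewrite mulr0.
rewrite (prim_expr_mod (zeta_prim R r_gt0)).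
by rewrite exprD Gn_colorE // [RHS]mulrC mulrA.
Qed.

Lemma face_point_eq0 s i : (face_point s i == 0) = (color s i == None).
Proof.
rewrite /face_point; case: (color s i) => [c|]; last by rewrite !eqxx.
by rewrite mulf_eq0 pnatr_eq0 /= expf_eq0 (negPf zeta_neq0) andbF.
Qed.

Lemma face_pointX s i c : color s i = Some c ->
  face_point s i ^+ r = (letter_pos s i - has_zero_block s).+1%:R ^+ r.
Proof.
rewrite /face_point => ->; rewrite exprMn exprAC.
by rewrite (prim_expr_order (zeta_prim R r_gt0)) expr1n mulr1.
Qed.

Section OneFace.
Variable s : colored_blocks.
Hypothesis s_face : is_face s.

Let s_uniq : uniq (blocks s). Proof. by case/and4P: s_face. Qed.

Let s_part : partition [set X in blocks s] [set: 'I_n].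
Proof. by case/and4P: s_face. Qed.

Lemma letter_pos_size i : (letter_pos s i < size (blocks s))%N.
Proof.
rewrite -has_find; have : i \in cover [set X in blocks s].
  by rewrite (cover_partition s_part) inE.
by case/bigcupP=> X; rewrite inE => Xs iX; apply/hasP; exists X.
Qed.

Lemma letter_pos_mem i : i \in nth set0 (blocks s) (letter_pos s i).
Proof.
apply: (@nth_find _ set0 (fun X : {set 'I_n} => i \in X)).
by rewrite has_find letter_pos_size.
Qed.

Lemma letter_posE i j : (j < size (blocks s))%N ->
  (i \in nth set0 (blocks s) j) = (letter_pos s i == j).
Proof.
move=> lt_j; apply/idP/eqP => [ij|<-]; last exact: letter_pos_mem.
apply/eqP; rewrite -(nth_uniq set0 _ _ s_uniq) ?letter_pos_size //.
case/and3P: s_part => _ /trivIsetP triv _; apply/negPn/negP => ne.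
have := triv _ _ _ _ ne; rewrite !inE !mem_nth ?letter_pos_size // => /(_ isT isT).
by move/pred0P/(_ i); rewrite /= letter_pos_mem ij.
Qed.

Lemma block_nonempty j : (j < size (blocks s))%N ->
  exists i, letter_pos s i = j.
Proof.
move=> lt_j; case/and3P: s_part => _ _ no0.
have [i ij] : exists i, i \in nth set0 (blocks s) j.
  by apply/set0Pn; apply: contraNneq no0 => <-; rewrite inE mem_nth.
by exists i; apply/eqP; rewrite -letter_posE.
Qed.

Lemma mem_first_block i : (i \in first_block s) = (letter_pos s i == 0%N).
Proof.
rewrite -letter_posE /first_block ?nth0 //.
exact: leq_trans (letter_pos_size i).
Qed.

Lemma color_eqNone i : (color s i == None) = has_zero_block s && (letter_pos s i == 0%N).
Proof.
rewrite -mem_first_block; case/and4P: s_face => _ _ /forallP/(_ i).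
rewrite /has_zero_block; have [i1 _|i1 /= /negPf->] := boolP (i \in _); last first.
  by rewrite andbF.
have -> : blocks s != [::].
  by apply: contraTneq i1; rewrite /first_block => ->; rewrite inE.
rewrite andbT /=; case/orP=> /forall_inP all1; last first.
  by rewrite all1 //; apply/esym/forall_inP.
rewrite (negPf (all1 i i1)); apply/esym/negbTE/negP => /forall_inP/(_ i i1).
by rewrite (negPf (all1 i i1)).
Qed.

Lemma has_zero_blockE : has_zero_block s = [exists i, color s i == None].
Proof.
apply/idP/existsP => [hz|[i iN]]; last by move: iN; rewrite color_eqNone => /andP[].
have /block_nonempty[i i0] : (0 < size (blocks s))%N.
  by case/andP: hz; case: (blocks s).
by exists i; rewrite color_eqNone hz i0.
Qed.

Lemma has_zero_leq i c : color s i = Some c -> (has_zero_block s <= letter_pos s i)%N.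
Proof.
move=> ic; have := color_eqNone i; rewrite ic; case: has_zero_block => //=.
by move/esym/negbT; rewrite lt0n.
Qed.

End OneFace.

(** The zeros of the point give the zero block; the [r]-th power of a nonzero
    coordinate gives the block of the letter, and then its argument the
    color. *)
Lemma face_point_inj s t : is_face s -> is_face t -> face_dim s = face_dim t ->
  face_point s = face_point t -> s = t.
Proof.
move=> fs ft st_dim st.
have stN i : (color s i == None) = (color t i == None).
  by rewrite -!face_point_eq0 st.
have st_zero : has_zero_block s = has_zero_block t.
  by rewrite !has_zero_blockE //; apply: eq_existsb.
have st_letter i : letter_pos s i = letter_pos t i /\ color s i = color t i.
  have := stN i; have := congr1 (fun f => f i) st.
  case sc: (color s i) => [c|]; case tc: (color t i) => [d|] // stE _; last first.
    split=> //; have := color_eqNone fs i; have := color_eqNone ft i.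
    by rewrite sc tc eqxx => /esym/andP[_ /eqP ->] /esym/andP[_ /eqP ->].
  have st_pos : letter_pos s i = letter_pos t i.
    have := congr1 (fun x => x ^+ r) stE; rewrite (face_pointX sc) (face_pointX tc).
    rewrite -!natrX => /eqP; rewrite eqr_nat eqn_exp2r // eqSS st_zero => /eqP.
    move: (has_zero_leq fs sc) (has_zero_leq ft tc); rewrite st_zero; lia.
  split=> //; move: stE; rewrite /face_point sc tc st_pos st_zero.
  move/mulfI; rewrite pnatr_eq0 => /(_ isT) /eqP.
  rewrite (eq_prim_root_expr (zeta_prim R r_gt0)) !modn_small // => /eqP cd.
  by congr Some; apply: val_inj.
have st_size : size (blocks s) = size (blocks t).
  have le_hz (u : colored_blocks) : (has_zero_block u <= size (blocks u))%N.
    rewrite /has_zero_block; case: (blocks u) => //= X l.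
    exact: leq_trans (leq_b1 _) _.
  move: st_dim (le_hz s) (le_hz t); rewrite /face_dim st_zero; lia.
have st_blocks : blocks s = blocks t.
  apply: (@eq_from_nth _ set0) => // j lt_j; apply/setP => i.
  by rewrite !letter_posE -?st_size // (st_letter i).1.
have st_color : color s = color t by apply/ffunP => i; case: (st_letter i).
case: s t st_blocks st_color {fs ft st_dim st stN st_zero st_letter st_size}
  => [sb sc] [tb tc].
by rewrite /blocks /color /= => /val_inj -> ->.
Qed.

Definition block_values k : seq C := [seq j.+1%:R ^+ r | j <- iota 0 k].

Lemma block_values_uniq k : uniq (block_values k).
Proof.
rewrite map_inj_uniq ?iota_uniq // => i j /eqP.
by rewrite -!natrX eqr_nat eqn_exp2r // => /eqP[].
Qed.

Lemma face_point_locus k (z : bool) s : is_F k s -> z || ~~ has_zero_block s ->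
  in_locus r (block_values k) z (face_point s).
Proof.
case/andP=> fs /eqP ds hz; split=> [i|c /mapP[j]].
  case ic: (color s i) => [c|]; last first.
    have := color_eqNone fs i; rewrite ic eqxx => /esym/andP[sz _].
    by move: hz; rewrite sz orbF => ->; rewrite face_point_eq0 ic eqxx orbT.
  rewrite (face_pointX ic); apply/orP; left; apply: (map_f (fun j => j.+1%:R ^+ r)).
  rewrite mem_iota /= add0n -ds /face_dim ltn_sub2r // ?letter_pos_size //.
  exact: leq_ltn_trans (has_zero_leq fs ic) (letter_pos_size fs i).
rewrite mem_iota /= add0n -ds /face_dim ltn_subRL addnC => lt_j ->.
have [i ij] := block_nonempty fs lt_j; exists i.
case ic: (color s i) => [c'|]; first by rewrite (face_pointX ic) ij addnK.
have := color_eqNone fs i; rewrite ic eqxx ij => /esym/andP[->].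
by rewrite addn1.
Qed.

End FacePoints.

(** * Faces from words *)

Section WordFaces.
Local Open Scope nat_scope.
Variables (r n k : nat) (z : bool).
Hypothesis r_gt0 : 0 < r.
Implicit Types (w : seq nat) (i : 'I_n).

Let good w := (w \in words (k * r + z) n) && hits r (iota 0 k) w.

Definition word_class w i := nth 0 w i %/ r.

(** The word [w] has letters below [k * r + z]: the classes below [k] give the
    nonzero blocks, the remainders modulo [r] the colors, and the letter [k * r],
    alone in the class [k], gives the zero block. *)
Definition word_blocks w : seq {set 'I_n} :=
  [seq [set i | word_class w i == c] |
    c <- (if [exists i, word_class w i == k] then [:: k] else [::]) ++ iota 0 k].

Definition word_color w : {ffun 'I_n -> option 'I_r} :=
  [ffun i => if word_class w i < k
             then Some (Ordinal (ltn_pmod (nth 0 w i) r_gt0)) else None].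

Definition word_face w : colored_blocks r n :=
  (insubd ([bseq] : n.-bseq {set 'I_n}) (word_blocks w), word_color w).

Section OneWord.
Variable w : seq nat.
Hypothesis w_good : good w.

(* The classes of the blocks, in order: a zero block comes first. *)
Let labels := (if [exists i, word_class w i == k] then [:: k] else [::]) ++ iota 0 k.

Let w_size : size w = n.
Proof. by case/andP: w_good; rewrite mem_words => /andP[/eqP]. Qed.

Lemma word_letter_lt i : nth 0 w i < k * r + z.
Proof.
case/andP: w_good; rewrite mem_words => /andP[_ /allP w_lt] _.
by apply: w_lt; rewrite mem_nth // w_size.
Qed.

Lemma word_class_le i : word_class w i <= k.
Proof.
rewrite -ltnS ltn_divLR // mulSn; apply: leq_trans (word_letter_lt i) _.
by rewrite addnC leq_add2r (leq_trans (leq_b1 z)).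
Qed.

(** The class [k] contains no letter other than [k * r]: a letter is determined
    by its class and, below the class [k], by its color. *)
Lemma word_letterE i :
  nth 0 w i = word_class w i * r + (if word_class w i < k then nth 0 w i %% r else 0).
Proof.
case: ltnP => le_k; first exact: divn_eq.
have kE : word_class w i = k by apply/eqP; rewrite eqn_leq word_class_le.
have := leq_divM (nth 0 w i) r; rewrite -/(word_class w i) kE.
by have := word_letter_lt i; case: z => /=; lia.
Qed.

Lemma mem_labels c : (c \in labels) = [exists i, word_class w i == c].
Proof.
have hit j : j < k -> [exists i, word_class w i == j].
  case/andP: w_good => _ /allP hw lt_jk; have := hw j; rewrite mem_iota lt_jk => /(_ isT).
  case/mapP => l /(nthP 0)[m lt_m <-] jE; rewrite w_size in lt_m.
  by apply/existsP; exists (Ordinal lt_m); rewrite jE.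
have le_k j : [exists i, word_class w i == j] -> j <= k.
  by case/existsP => i /eqP <-; apply: word_class_le.
rewrite /labels mem_cat mem_iota add0n /=.
have [lt_ck|lt_kc|->] := ltngtP c k.
- by rewrite orbT hit.
- rewrite orbF; apply/idP/idP => [|/le_k]; last by rewrite leqNgt lt_kc.
  by case: ifP => //; rewrite inE => _ /eqP E; move: lt_kc; rewrite E ltnn.
- by case: ifP => // _; rewrite inE eqxx.
Qed.

Lemma labels_uniq : uniq labels.
Proof.
rewrite cat_uniq iota_uniq andbT; apply/andP; split; first by case: ifP.
apply/hasPn => j; rewrite mem_iota add0n /= => lt_jk; case: ifP => // _.
by rewrite inE ltn_eqF.
Qed.

Lemma blocks_word_face : blocks (word_face w) = word_blocks w.
Proof.
rewrite /blocks /= val_insubd ifT // size_map -/labels -[X in _ <= X]w_size.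
rewrite -(size_map (fun j => j %/ r)); apply: uniq_leq_size; first exact: labels_uniq.
move=> c; rewrite mem_labels => /existsP[i /eqP <-]; apply: map_f.
by rewrite mem_nth // w_size.
Qed.

Let class_in i : word_class w i \in labels.
Proof. by rewrite mem_labels; apply/existsP; exists i. Qed.

Lemma letter_pos_word i : letter_pos (word_face w) i = index (word_class w i) labels.
Proof.
rewrite /letter_pos blocks_word_face /word_blocks find_map -/labels.
by apply: eq_find => c /=; rewrite inE eq_sym.
Qed.

Lemma color_word_None i : (color (word_face w) i == None) = (word_class w i == k).
Proof.
rewrite /color /= ffunE; case: ltnP => [lt_k|le_k]; first by rewrite ltn_eqF.
by rewrite eqxx eqn_leq word_class_le le_k.
Qed.

Let mem_block c : c \in labels -> exists i, word_class w i = c.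
Proof. by rewrite mem_labels => /existsP[i /eqP]; exists i. Qed.

Lemma mem_first_word i : (i \in first_block (word_face w)) =
  (word_class w i == head 0 labels).
Proof.
rewrite /first_block blocks_word_face /word_blocks -/labels.
have := class_in i; case: labels => [//|c l] _.
by rewrite /= inE.
Qed.

Lemma word_face_is_face : is_face (word_face w).
Proof.
have zero_head i : word_class w i == k -> head 0 labels = k.
  by rewrite /labels => ik; rewrite ifT //; apply/existsP; exists i.
apply/and4P; split.
- rewrite blocks_word_face map_inj_in_uniq ?labels_uniq // => c d /mem_block[i <-] _.
  by move=> /setP/(_ i); rewrite !inE eqxx => /esym/eqP.
- rewrite blocks_word_face; apply/and3P; split.
  + rewrite -subTset; apply/subsetP => i _; apply/bigcupP.
    exists [set j | word_class w j == word_class w i]; last by rewrite inE.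
    by rewrite inE; apply: (map_f (fun c => [set j | word_class w j == c])).
  + apply/trivIsetP => X Y; rewrite !inE => /mapP[c _ ->] /mapP[d _ ->] ne.
    apply/pred0P => i /=; rewrite !inE; apply/negP => /andP[/eqP ic /eqP jc].
    by move: ne; rewrite -ic jc eqxx.
  + rewrite inE; apply/mapP => -[c /mem_block[i ic]] /setP/(_ i).
    by rewrite !inE ic eqxx.
- apply/forallP => i; apply/implyP; rewrite mem_first_word color_word_None.
  by apply: contra => ik; rewrite (zero_head i ik).
case: (boolP [exists i, word_class w i == k]) => [/existsP[i ik]|/existsPn no_k].
  apply/orP; right; apply/forall_inP => j.
  by rewrite mem_first_word color_word_None (zero_head i ik).
by apply/orP; left; apply/forall_inP => j _; rewrite color_word_None.
Qed.

Lemma has_zero_word : has_zero_block (word_face w) = [exists i, word_class w i == k].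
Proof.
rewrite (has_zero_blockE word_face_is_face); apply: eq_existsb => i.
exact: color_word_None.
Qed.

Lemma word_face_F : is_F k (word_face w) && (z || ~~ has_zero_block (word_face w)).
Proof.
rewrite /is_F word_face_is_face /= /face_dim blocks_word_face /word_blocks size_map.
rewrite has_zero_word size_cat size_iota; apply/andP; split.
  by case: ifP => _; rewrite /= ?add0n ?subn0 // add1n subn1.
case: (boolP z) => //= /negPf z0; apply/existsPn => i.
have := word_letter_lt i; rewrite z0 addn0 -ltn_divLR // => lt_k.
by rewrite ltn_eqF.
Qed.

End OneWord.

(** Words with the same face both have a zero block or both have none, so their
    blocks have the same labels, and the position of its block determines the
    class of a letter. *)
Lemma word_face_inj : {in good &, injective word_face}.
Proof.
move=> w w' gw gw' ww'.
have size_good u : good u -> size u = n.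
  by case/andP; rewrite mem_words => /andP[/eqP].
apply: (@eq_from_nth _ 0); first by rewrite !size_good.
rewrite size_good // => m lt_mn; pose i := Ordinal lt_mn.
rewrite -[m]/(val i).
have labE : [exists i, word_class w i == k] = [exists i, word_class w' i == k].
  by rewrite -!has_zero_word // ww'.
have class_eq : word_class w i = word_class w' i.
  have := letter_pos_word gw i; rewrite ww' (letter_pos_word gw') -labE.
  move/esym => idx; apply: (index_inj 0 _ _ idx).
    by rewrite mem_labels //; apply/existsP; exists i.
  by rewrite labE mem_labels //; apply/existsP; exists i.
rewrite (word_letterE gw) (word_letterE gw') -class_eq; congr (_ + _).
have := congr1 (fun s => color s i) ww'; rewrite /color /= !ffunE -class_eq.
by case: ifP => // _ [].
Qed.

Lemma card_faces (P : pred (colored_blocks r n)) :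
    (forall s, P s = is_F k s && (z || ~~ has_zero_block s)) ->
  count (hits r (iota 0 k)) (words (k * r + z) n) <= #|P|.
Proof.
move=> PE; rewrite -size_filter -(size_map word_face) cardE.
apply: uniq_leq_size => [|_ /mapP[w + ->]].
  rewrite map_inj_in_uniq ?filter_uniq ?words_uniq // => w w'.
  rewrite !mem_filter => /andP[hw mw] /andP[hw' mw'].
  by apply: word_face_inj; rewrite /in_mem /= /good ?mw ?mw'.
rewrite mem_filter => /andP[hw mw]; rewrite mem_enum unfold_in PE.
by apply: word_face_F; rewrite /good mw.
Qed.

End WordFaces.

(** * The two isomorphisms *)

Section Assembly.
Variables (R : realType) (r n k : nat) (z : bool).
Local Notation blocks_gset := (blocks_gset R r n).
Variable P : pred blocks_gset.
Hypothesis P_stable : forall (A : Gn R r n) (s : blocks_gset), P s -> P (gset_act A s).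
Hypothesis PE : forall s, P s = is_F k s && (z || ~~ has_zero_block s).
Hypothesis r_gt0 : (0 < r)%N.
Hypothesis le_kn : (k <= n)%N.

Theorem quotient_iso_faces : gmod_iso
  (@quot_gmodule R[i] (Gn R r n) (poly_gmodule R r n)
    (ideal (power_gens R r n (k * r + z) k)) (@power_ideal_stable R r n (k * r + z) k))
  (perm_module R[i] (sub_gset P_stable)).
Proof.
apply: (@locus_iso R r n k z (block_values R r k) (sub_gset P_stable)
  (fun s => face_point R (val s))) => //.
- exact: block_values_uniq.
- by rewrite size_map size_iota.
- move=> s t st; apply: val_inj; have := valP s; have := valP t; rewrite /= !PE.
  move=> /andP[/andP[ft /eqP dt] _] /andP[/andP[fs /eqP ds] _].
  by apply: (face_point_inj r_gt0 fs ft) st; rewrite ds dt.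
- by move=> s; have := valP s; rewrite /= PE => /andP[Fs zs]; apply: face_point_locus.
- by move=> A s l; apply: face_point_act.
have S_le c : c \in iota 0 k -> (c.+1 * r <= k * r + z)%N.
  rewrite mem_iota add0n => /= lt_ck; apply: leq_trans (leq_addr _ _).
  by rewrite leq_mul2r lt_ck orbT.
have := count_hits r_gt0 (@var R[i] n) n (iota_uniq 0 k) S_le.
rewrite size_iota => <-; rewrite card_sig; exact: card_faces.
Qed.

End Assembly.

Theorem corollary4p12 (R : realType) (r n k : nat)
    (hr : (2 <= r)%N) (hn : (1 <= n)%N) (hk : (0 <= k <= n)%N) :
  gmod_iso (R_module R r n k) (perm_module R[i] (F_gset R r n k)) /\
  gmod_iso (S_module R r n k) (perm_module R[i] (OP_gset R r n k)).
Proof.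
have r_gt0 := ltnW hr; split.
  have := @quotient_iso_faces R r n k true (is_F k) (@is_F_act R r n k).
  rewrite addn1; apply=> // s; by rewrite andbT.
have := @quotient_iso_faces R r n k false (is_OP k) (@is_OP_act R r n k).
by rewrite addn0; apply.
Qed.
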